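(* In dimension one, $G_Q(1)=G(1)/4=\pi^2/16$, and the infimum defining $G_Q(1)$ is not attained.
   Context: $G(1)=\inf_{0\ne u\in H^1(\mathbb{R})}\frac{\int_{\mathbb{R}}(u')^2\left(\int_{\mathbb{R}}u^2\right)^{2}}{\int_{\mathbb{R}}u^{6}}$. With $I=[0,1]$, $G_Q(1)=\inf\frac{\int_I (u')^2\left(\int_I u^2\right)^2}{\int_I|u-u_I|^{6}}$, the infimum over (non-constant) $u\in W^{1,1}(I)$, where $u_I=\int_I u$. *)

(* Defs.v *)
From HB Require Import structures.
From mathcomp Require Import all_boot all_order all_algebra.
From mathcomp Require Import all_classical all_reals all_analysis.
Set Implicit Arguments. Unset Strict Implicit. Unset Printing Implicit Defensive.
Import Order.TTheory GRing.Theory Num.Theory.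
Import numFieldNormedType.Exports.
Local Open Scope classical_set_scope.
Local Open Scope ring_scope.

Section Defs.
Variable R : realType.
Local Notation mu := (@lebesgue_measure R).
Definition I01 : set R := `[0%R, 1%R].

Definition sint (a b : R) (g : R -> R) : R :=
  if a <= b then Rintegral mu `[a, b] g else - Rintegral mu `[b, a] g.

(* u belongs to H^1(R) with weak derivative g : u, g in L^2(R) and
   u coincides a.e. with the (absolutely continuous) function c + \int_0^x g.
   This is the standard description of H^1(R) (ACL characterisation). *)
Definition H1R (u g : R -> R) : Prop :=
  measurable_fun setT u /\ measurable_fun setT g /\
  mu.-integrable setT (fun x => (u x ^+ 2)%:E) /\
  mu.-integrable setT (fun x => (g x ^+ 2)%:E) /\
  exists c : R, {ae mu, forall x, u x = c + sint 0 x g}.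

(* u belongs to W^{1,1}(I), I = [0,1], with weak derivative g : g in L^1(I)
   and u = c + \int_0^x g a.e. on I. *)
Definition W11I (u g : R -> R) : Prop :=
  measurable_fun I01 u /\ measurable_fun I01 g /\
  mu.-integrable I01 (EFin \o g) /\
  exists c : R, {ae mu, forall x, x \in I01 -> u x = c + Rintegral mu `[0, x] g}.

Definition quotR (u g : R -> R) : \bar R :=
  ((\int[mu]_x (g x ^+ 2)%:E) * (\int[mu]_x (u x ^+ 2)%:E) ^+ 2
     / (\int[mu]_x (u x ^+ 6)%:E))%E.

Definition meanI (u : R -> R) : R := Rintegral mu I01 u.

Definition quotI (u g : R -> R) : \bar R :=
  ((\int[mu]_(x in I01) (g x ^+ 2)%:E) *
   (\int[mu]_(x in I01) (u x ^+ 2)%:E) ^+ 2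
     / (\int[mu]_(x in I01) (`|u x - meanI u| ^+ 6)%:E))%E.

Definition G1 : \bar R :=
  ereal_inf [set q | exists u g : R -> R,
      [/\ H1R u g, ~ {ae mu, forall x, u x = 0} & q = quotR u g]].

Definition nonconstI (u : R -> R) : Prop :=
  ~ exists c : R, {ae mu, forall x, x \in I01 -> u x = c}.

Definition GQ1 : \bar R :=
  ereal_inf [set q | exists u g : R -> R,
      [/\ W11I u g, nonconstI u & q = quotI u g]].
End Defs.

(* Main.v *)
Require Import Defs.
From HB Require Import structures.
From mathcomp Require Import all_boot all_order all_algebra.
From mathcomp Require Import all_classical all_reals all_analysis.
From mathcomp Require Import measurable_realfun ring lra.
Set Implicit Arguments. Unset Strict Implicit. Unset Printing Implicit Defensive.
Import Order.TTheory GRing.Theory Num.Theory.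
Import numFieldNormedType.Exports.
Local Open Scope classical_set_scope.
Local Open Scope ring_scope.

(** Both lower bounds come from one calibration. If u(p)^2 = M is the maximum of
    u^2 on a segment, Young's inequality
    u'^2 + l^2 (M^2 u^2 - u^6) >= 2 l |u' u| sqrt (M^2 - u^4)
    integrates exactly: moving from height 0 up to the maximum costs at least
    l (pi/4) M^2. On the line the maximum is left on both sides, and l = pi/(2B)
    with B the integral of u^2 makes the terms in M cancel, which gives pi^2/4.
    On [0,1] a mean-zero function has a zero, so the cost is only paid once;
    l = pi/(4B) gives pi^2/16, and the part of u beyond its zero, where the
    integrand is still positive, makes the inequality strict.
    The optimal profile on the line is cosh(2x)^(-1/2); on [0,1] its right half,
    rescaled by k and k -> oo, is a minimizing sequence because its mean tends
    to 0. *)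

Local Notation "\I[ a , b ] f" := (Rintegral (@lebesgue_measure _) `[a, b] f)
  (at level 36, f at level 36, a, b at level 10, format "\I[ a ,  b ]  f").

(** The functions are only absolutely continuous, so differential calculus is applied to the smooth
    function Phi alone, and u enters through its increments, which are integrals of the weak
    derivative. The number pi/4 is the area of a quarter disc: with r = s^2 / M, 2 l times the
    integral of s sqrt (M^2 - s^4) over 0 <= s <= sqrt M is l M^2 times the integral of sqrt (1 -
    r^2) over [0, 1]. After the terms in M cancel, what remains is l^2 C <= A, with A and C the
    integrals of u'^2 and u^6. Multiplying by B^2 turns it into (l B)^2 C <= A B^2, so halving l
    divides the constant by 4. The same factor is seen on the optimal profile: keeping one half of
    it halves all three integrals, and A B^2 / C drops to a quarter. The quotient on [0,1] subtracts
    the mean m only in the denominator. For the lower bound this is harmless, because the integral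
    of u^2 is that of (u - m)^2 plus m^2. For the upper bound m has to be shown negligible in the
    denominator. On the line there is no end point where u is known to vanish; the argument runs on
    segments at whose ends u^2 is small, with an error that tends to 0. *)

Definition locint (R : realType) (f : R -> R) : Prop :=
  forall a b : R, (@lebesgue_measure R).-integrable `[a, b] (EFin \o f).

(** * Integrals over segments, and monotonicity from a local condition *)

Section segment_integral.
Variable R : realType.
Notation mu := (@lebesgue_measure R).
Implicit Types (a b c x y k : R) (f h : R -> R).

Lemma continuous_locint f : continuous f -> locint f.
Proof.
move=> cf a b; apply: continuous_compact_integrable.
  exact: segment_compact.
exact: continuous_subspaceT.
Qed.

Lemma integrable_locint f : mu.-integrable setT (EFin \o f) -> locint f.
Proof. by move=> fi a b; exact: integrableS fi. Qed.

Lemma locintD f h : locint f -> locint h -> locint (fun x => f x + h x).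
Proof. by move=> fi hi a b; apply: integrableD (fi a b) (hi a b). Qed.

Lemma locintZ k f : locint f -> locint (fun x => k * f x).
Proof. by move=> fi a b; apply: integrableZl (fi a b). Qed.

Lemma segment_integral_cat f a b c : locint f -> a <= b -> b <= c ->
  \I[a, c] f = \I[a, b] f + \I[b, c] f.
Proof.
move=> fi ab bc.
have := @Rintegral_itvB R f (BLeft a) (BRight c) b (fi a c).
rewrite !bnd_simp => /(_ ab bc).
rewrite Rintegral_itv_obnd_cbnd => [<-|]; first by rewrite addrC subrK.
by apply: integrableS (fi b c) => //; apply: subset_itvr; rewrite bnd_simp.
Qed.

Lemma segment_integral_le f h a b : locint f -> locint h ->
  (forall x, a <= x <= b -> f x <= h x) -> \I[a, b] f <= \I[a, b] h.
Proof.
by move=> fi hi fh; apply: le_Rintegral.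
Qed.

Lemma segment_integral_ge0 f a b :
  (forall x, a <= x <= b -> 0 <= f x) -> 0 <= \I[a, b] f.
Proof.
by move=> f0; apply: Rintegral_ge0 => x /=; rewrite in_itv/=; exact: f0.
Qed.

Lemma segment_integralD f h a b : locint f -> locint h ->
  \I[a, b] (fun x => f x + h x) = \I[a, b] f + \I[a, b] h.
Proof. by move=> fi hi; rewrite RintegralD. Qed.

Lemma segment_integralZ k f a b : locint f ->
  \I[a, b] (fun x => k * f x) = k * \I[a, b] f.
Proof. by move=> fi; rewrite RintegralZl. Qed.

Lemma segment_integral_cst k a b : a <= b -> \I[a, b] (fun=> k) = k * (b - a).
Proof.
move=> ab; rewrite Rintegral_cst//= lebesgue_measure_itv/= lte_fin.
by case: ltgtP ab => // [<-]; rewrite subrr.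
Qed.

Lemma eq_segment_integral f h a b :
  (forall x, a <= x <= b -> f x = h x) -> \I[a, b] f = \I[a, b] h.
Proof.
by move=> fh; apply: eq_Rintegral => x; rewrite inE/= in_itv/=; exact: fh.
Qed.

Lemma segment_integral_gt0 f a b z : a < b -> continuous f ->
  (forall x, a <= x <= b -> 0 <= f x) -> a <= z <= b -> 0 < f z ->
  0 < \I[a, b] f.
Proof.
move=> ab cf f0 zab fz.
have [d /= d0 dP] : exists2 d, 0 < d & forall t, `|z - t| < d -> f z / 2 <= f t.
  have h : f z / 2 < f z by lra.
  have : \forall t \near z, f z / 2 <= f t by apply: cvgr_ge (cf z) _ h.
  move=> /nbhs_ballP[d /= d0 dP].
  by exists d => // t zt; exact: (dP t zt).
(* The point [z] may be an end point: the subsegment lies to its right when [z = a] and to its left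
   otherwise. *)
have [x [y [ax xy yb xyd]]] : exists x y, [/\ a <= x, x < y, y <= b &
    forall t, x <= t <= y -> `|z - t| < d].
  case/andP: zab; rewrite le_eqVlt => /orP[/eqP <- _|az zb].
    exists a, (Num.min b (a + d / 2)); rewrite lexx lt_min ab/= ge_min lexx.
    split => //; first lra.
    by move=> t /andP[]; rewrite le_min => ? /andP[? ?]; rewrite ltr_norml; lra.
  exists (Num.max a (z - d / 2)), z; rewrite le_max lexx/= zb gt_max az/=.
  split => //; first lra.
  by move=> t /andP[]; rewrite ge_max => /andP[? ?] ?; rewrite ltr_norml; lra.
have fi := continuous_locint cf.
rewrite (@segment_integral_cat _ _ x)// ?(ltW (lt_le_trans xy yb))//.
rewrite (@segment_integral_cat _ x y)// ?(ltW xy)//.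
have I1 : 0 <= \I[a, x] f.
  by apply: segment_integral_ge0 => t ?; apply: f0; lra.
have I2 : 0 <= \I[y, b] f.
  by apply: segment_integral_ge0 => t ?; apply: f0; lra.
have I3 : \I[x, y] (fun=> f z / 2) <= \I[x, y] f.
  apply: segment_integral_le => //; first by apply: continuous_locint => ?; exact: cvg_cst.
  by move=> t txy; apply: dP; exact: xyd.
have := segment_integral_cst (f z / 2) (ltW xy) => e; rewrite e in I3.
have : 0 < f z / 2 * (y - x) by rewrite mulr_gt0//; lra.
lra.
Qed.

(** Supremum argument on the points whose value is at least [E a]. No continuity of [E] is assumed,
    so the local condition at [sup S] is applied to a point of [S] close to the supremum and a point
    beyond it, which jumps over [sup S] itself. *)
Lemma locally_nondecreasing_le (E : R -> R) a b : a <= b ->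
  (forall z, a <= z <= b -> exists2 d, 0 < d & forall x y,
     a <= x -> x <= y -> y <= b -> `|z - x| < d -> `|z - y| < d -> E x <= E y) ->
  E a <= E b.
Proof.
move=> ab loc.
pose S := [set x | a <= x <= b /\ E a <= E x].
have Sa : S a by split; rewrite ?lexx.
have hS : has_sup S by split; [exists a | exists b => x [/andP[]]].
have aS : a <= sup S by apply: ub_le_sup => //; case: hS.
have Sb : sup S <= b by apply: ge_sup; [exists a | move=> x [/andP[]]].
have [|d d0 dP] := loc (sup S); first by rewrite aS.
have [x [/andP[ax xb] Ex] sx] := sup_adherent d0 hS.
have xS : x <= sup S by apply: ub_le_sup; [case: hS | split; rewrite ?ax].
have : E x <= E (Num.min b (sup S + d / 2)).
  have h : sup S <= Num.min b (sup S + d / 2) by rewrite le_min Sb; lra.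
  apply: dP => //; rewrite ?ge_min ?lexx//.
  - exact: le_trans h.
  - by rewrite ltr_norml; lra.
  - rewrite ltr_norml; have : Num.min b (sup S + d / 2) <= sup S + d / 2.
      by rewrite ge_min lexx orbT.
    lra.
move=> /(le_trans Ex).
case: (leP b (sup S + d / 2)) => // h Ey.
have : sup S + d / 2 <= sup S by apply: ub_le_sup; [case: hS | split => //; lra].
lra.
Qed.

End segment_integral.

(** * Young's inequality integrated along an absolutely continuous function *)

Section calibration.
Variable R : realType.
Notation mu := (@lebesgue_measure R).
Implicit Types (a b l m N s t x y : R) (v g Phi psi : R -> R).

(** Only increments are recorded, so the notion has no base point and is unchanged when a constant
    such as the mean is subtracted. *)
Definition primitive v g := forall x y, x <= y -> v y - v x = \I[x, y] g.

(* This replaces the chain rule for the absolutely continuous function v: the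
   last hypothesis is the mean value theorem with p = Phi'(xi), and Young's
   inequality is applied on short segments, where p can be taken constant. *)
Lemma young_segment v g Phi psi a b l : a <= b ->
  locint g -> locint (fun x => g x ^+ 2) -> primitive v g ->
  continuous v -> continuous psi ->
  (forall x y, a <= x <= b -> a <= y <= b -> exists xi p,
    [/\ Num.min (v x) (v y) <= xi, xi <= Num.max (v x) (v y),
        Phi (v y) - Phi (v x) = p * (v y - v x) & p ^+ 2 <= psi xi]) ->
  2 * l * (Phi (v b) - Phi (v a)) <=
    \I[a, b] (fun x => g x ^+ 2 + l ^+ 2 * psi (v x)).
Proof.
move=> ab gi g2i vg cv cpsi mvt.
have cpv : continuous (psi \o v) by move=> x; apply: continuous_comp; [exact: cv | exact: cpsi].
have psii : locint (fun x => l ^+ 2 * psi (v x)).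
  by apply: locintZ; exact: continuous_locint.
have hi := locintD g2i psii.
have ci (k : R) : locint (fun=> k).
  by apply: continuous_locint => ?; exact: cvg_cst.
suff key (e : R) : 0 < e -> 2 * l * (Phi (v b) - Phi (v a)) <=
    \I[a, b] (fun x => g x ^+ 2 + l ^+ 2 * psi (v x)) + e * (b - a).
  apply/ler_addgt0Pr => e e0; apply: (le_trans (key (e / (b - a + 1)) _)).
    by rewrite divr_gt0//; lra.
  rewrite lerD2l mulrAC ler_pdivrMr; last lra.
  by rewrite ler_pM2l//; lra.
(* [psi xi] is compared with [psi (v t)] through [psi (v z)], two errors of size [e']; the choice
   makes l^2 times their sum at most [e], also when l = 0. *)
move=> e0; pose e' := e / (l ^+ 2 + 1) / 2.
have l0 : 0 <= l ^+ 2 by exact: sqr_ge0.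
have e'0 : 0 < e' by rewrite /e' !divr_gt0//; lra.
have le' : l ^+ 2 * (e' + e') <= e.
  have -> : l ^+ 2 * (e' + e') = (l ^+ 2 / (l ^+ 2 + 1)) * e.
    by rewrite /e'; field; lra.
  by rewrite ger_pMl// ler_pdivrMr; lra.
pose h x := g x ^+ 2 + l ^+ 2 * psi (v x) + e.
have hei : locint h := locintD hi (ci e).
pose E x := \I[a, x] h - 2 * l * Phi (v x).
suff : E a <= E b.
  rewrite /E set_itv1 Rintegral_set1 (segment_integralD _ _ hi (ci e)).
  by rewrite segment_integral_cst//; lra.
apply: locally_nondecreasing_le => // z zab.
have [d1 /= d10 d1P] : exists2 d1 : R, 0 < d1 &
    forall xi, `|v z - xi| < d1 -> `|psi (v z) - psi xi| < e'.
  have : \forall xi \near v z, `|psi (v z) - psi xi| < e'.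
    exact: (cvgr_dist_lt _ _ (cpsi (v z)) _ e'0).
  by move=> /nbhs_ballP[d1 /= d10 d1P]; exists d1 => // xi xz; exact: (d1P xi xz).
have [d /= d0 dP] : exists2 d : R, 0 < d & forall t, `|z - t| < d -> `|v z - v t| < d1.
  have : \forall t \near z, `|v z - v t| < d1 by exact: (cvgr_dist_lt _ _ (cv z) _ d10).
  by move=> /nbhs_ballP[d /= d0 dP]; exists d => // t zt; exact: (dP t zt).
exists d => // x y ax xy yb zx zy.
have [||xi [p [xi1 xi2 Phixy ppsi]]] := mvt x y; try by lra.
have xiz : `|v z - xi| < d1.
  move: (dP _ zx) (dP _ zy) xi1 xi2; rewrite !ltr_norml.
  by case: (leP (v x) (v y)) => _; lra.
rewrite /E (segment_integral_cat hei ax xy) -subr_ge0.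
rewrite [X in 0 <= X](_ : _ = \I[x, y] h - 2 * l * (Phi (v y) - Phi (v x))); last first.
  by ring.
rewrite Phixy vg// mulrA -segment_integralZ// subr_ge0.
apply: segment_integral_le => // [|t txy]; first exact: locintZ.
have tz : `|z - t| < d by move: zx zy; rewrite !ltr_norml; lra.
have := d1P _ xiz; have := d1P _ (dP _ tz); rewrite !ltr_norml /h => h1 h2.
have psile : l ^+ 2 * psi xi <= l ^+ 2 * psi (v t) + e.
  apply: (@le_trans _ _ (l ^+ 2 * (psi (v t) + (e' + e')))); last by lra.
  by rewrite ler_wpM2l//; lra.
have := ler_wpM2l l0 ppsi; have := sqr_ge0 (g t - l * p).
move=> ? ?; have -> : 2 * l * p * g t = g t ^+ 2 + l ^+ 2 * p ^+ 2 - (g t - l * p) ^+ 2 by ring.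
by lra.
Qed.

End calibration.

(** * The calibrating antiderivative *)

Section profile.
Variable R : realType.
Notation mu := (@lebesgue_measure R).
Implicit Types (a b l m N s t x y : R) (v g Phi psi : R -> R).

Lemma MVT_between (F f : R -> R) s t :
  (forall x, Num.min s t <= x <= Num.max s t -> is_derive x 1 F (f x)) ->
  exists xi, [/\ Num.min s t <= xi, xi <= Num.max s t & F t - F s = f xi * (t - s)].
Proof.
wlog st : s t / s <= t.
  move=> H dF; case/orP: (le_total s t) => [st|ts]; first exact: H.
  have [|xi [h1 h2 h3]] := H t s ts.
    by move=> x; rewrite minC maxC; exact: dF.
  by exists xi; move: h1 h2; rewrite minC maxC (min_r ts) (max_l ts) => ? ?; split => //; lra.
rewrite (min_l st) (max_r st) => dF.
have [x||xi] := @MVT_segment _ F f s t st.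
- by rewrite in_itv/= => xst; apply: dF; lra.
- apply: derivable_within_continuous => x; rewrite in_itv/= => xst.
  exact: (@ex_derive _ _ _ _ _ _ _ (dF x xst)).
- by rewrite in_itv/= => /andP[? ?] ?; exists xi.
Qed.

(* A closed form of the antiderivative of s sqrt(N^2 - s^4), which calibrates
   u'^2 + l^2 (N^2 u^2 - u^6). Since asin is singular at 1 it is only used for
   s^2 < N; half_bound reaches s^2 = M as the limit e -> 0 of N = M / cos e. *)
Definition profile N s : R :=
  N ^+ 2 / 4 * (asin (s ^+ 2 / N) + sin (asin (s ^+ 2 / N)) * cos (asin (s ^+ 2 / N))).

(** The function x + sin x cos x has derivative 2 cos^2 x, and asin contributes one factor 1 / cos.
    Since cos (asin (s^2 / N)) = sqrt (1 - s^4 / N^2), the value is s sqrt (N^2 - s^4). *)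
Lemma is_derive_profile N s : 0 < N -> s ^+ 2 < N ->
  is_derive s 1 (profile N) (N * s * cos (asin (s ^+ 2 / N))).
Proof.
move=> N0 sN.
have h : -1 < s ^+ 2 / N < 1.
  have : 0 <= s ^+ 2 / N by rewrite divr_ge0// ?sqr_ge0// ltW.
  have : s ^+ 2 / N < 1 by rewrite ltr_pdivrMr// mul1r.
  by move=> ? ?; lra.
pose H (x : R) := x + sin x * cos x.
have dH (x : R) : is_derive x 1 H (2 * cos x ^+ 2).
  apply: is_derive_eq; rewrite /GRing.scale/=.
  have := cos2Dsin2 x; lra.
have dq : is_derive s 1 (fun s => s ^+ 2 / N) (2 * s / N).
  apply: is_derive_eq; rewrite /GRing.scale/=; field; lra.
have da := @is_derive1_comp R (@asin R) (fun s => s ^+ 2 / N) s _ _ (is_derive1_asin h) dq.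
have dHa := @is_derive1_comp R H _ s _ _ (dH _) da.
have -> : profile N = (N ^+ 2 / 4) *: (H \o (asin \o (fun s => s ^+ 2 / N))) by [].
apply: is_derive_eq; rewrite /GRing.scale/= -cos_asin; last lra.
have c0 : cos (asin (s ^+ 2 / N)) != 0.
  rewrite cos_asin ?sqrtr_eq0 -?ltNge ?subr_gt0; last lra.
  by rewrite expr2; nra.
by field; rewrite c0/=; lra.
Qed.

(** The mean value hypothesis of [young_segment] for psi(s) = s^2 (N^2 - s^4): [p] is the derivative
    at [xi], whose square is exactly psi(xi). *)
Lemma profile_MVT N s t : 0 < N -> s ^+ 2 < N -> t ^+ 2 < N -> exists xi p,
  [/\ Num.min s t <= xi, xi <= Num.max s t,
      profile N t - profile N s = p * (t - s) &
      p ^+ 2 <= xi ^+ 2 * (N ^+ 2 - xi ^+ 4)].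
Proof.
move=> N0 sN tN.
have h x : Num.min s t <= x <= Num.max s t -> x ^+ 2 < N.
  by have [x0|/ltW x0] := leP 0 x; case: (leP s t) => [_|/ltW _] /andP[? ?]; nra.
have [x xst|xi [h1 h2 h3]] := @MVT_between (profile N)
  (fun x => N * x * cos (asin (x ^+ 2 / N))) s t.
  exact/is_derive_profile/h.
exists xi, (N * xi * cos (asin (xi ^+ 2 / N))); split => //.
have xiN : xi ^+ 2 < N by apply: h; rewrite h1.
have q0 : 0 <= xi ^+ 2 / N by rewrite divr_ge0// ?sqr_ge0// ltW.
have q1 : xi ^+ 2 / N < 1 by rewrite ltr_pdivrMr// mul1r.
rewrite cos_asin; last lra.
rewrite exprMn sqr_sqrtr; last by rewrite subr_ge0 expr2; nra.
by rewrite le_eqVlt; apply/orP; left; apply/eqP; field; lra.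
Qed.

(** The profile vanishes at 0 and its slope is at most N |s| between 0 and [s]. This controls the
    loss at the low end of a segment, where [v] is small but need not vanish. *)
Lemma profile_le N s : 0 < N -> s ^+ 2 < N -> profile N s <= N * s ^+ 2.
Proof.
move=> N0 sN.
have z0 : 0 ^+ 2 < N by rewrite expr0n.
have [xi [p [h1 h2 h3 h4]]] := profile_MVT N0 z0 sN.
have p0 : profile N 0 = 0.
  by rewrite /profile expr0n mul0r -[X in asin X](@sin0 R) sinK ?in_itv/= ?sin0;
    have := pi_gt0 R; lra.
have x2 : xi ^+ 2 <= s ^+ 2 by move: h1 h2; case: (leP 0 s); nra.
have pN : p ^+ 2 <= (N * s) ^+ 2.
  have -> : (N * s) ^+ 2 = N ^+ 2 * s ^+ 2 by ring.
  have := ler_wpM2l (sqr_ge0 N) x2; have := sqr_ge0 (xi ^+ 3).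
  by move: h4; rewrite (_ : xi ^+ 2 * _ = N ^+ 2 * xi ^+ 2 - (xi ^+ 3) ^+ 2); [lra | ring].
rewrite p0 !subr0 in h3; rewrite h3.
have : `|p * s| <= `|N * s ^+ 2|.
  rewrite expr2 mulrA 2!normrM ler_wpM2r//.
  by rewrite -ler_sqr ?nnegrE// !real_normK ?num_real.
rewrite (ger0_norm (mulr_ge0 (ltW N0) (sqr_ge0 s))); apply: le_trans; exact: ler_norm.
Qed.

End profile.

(** * The cost of moving between the maximum and a low point *)

Section half_bound.
Variable R : realType.
Notation mu := (@lebesgue_measure R).
Implicit Types (a b l M N p q x y : R) (v g : R -> R).

Lemma continuousX (f : R -> R) n : continuous f -> continuous (fun x => f x ^+ n).
Proof.
move=> cf x; apply: (@continuous_comp _ _ _ f (@GRing.exp R ^~ n)); first exact: cf.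
exact: exprn_continuous.
Qed.

Lemma segment_integral_energy v g a b l N : locint (fun x => g x ^+ 2) -> continuous v ->
  \I[a, b] (fun x => g x ^+ 2 + l ^+ 2 * (v x ^+ 2 * (N ^+ 2 - v x ^+ 4))) =
  \I[a, b] (fun x => g x ^+ 2) +
    l ^+ 2 * (N ^+ 2 * \I[a, b] (fun x => v x ^+ 2) - \I[a, b] (fun x => v x ^+ 6)).
Proof.
move=> g2i cv.
have i2 := continuous_locint (continuousX (n := 2) cv).
have i6 := continuous_locint (continuousX (n := 6) cv).
transitivity (\I[a, b] (fun x => g x ^+ 2 +
    (l ^+ 2 * N ^+ 2 * v x ^+ 2 + - l ^+ 2 * v x ^+ 6))).
  by apply: eq_segment_integral => x _; ring.
rewrite segment_integralD//; last by apply: locintD; exact: locintZ.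
by rewrite segment_integralD; [rewrite !segment_integralZ//; ring|exact: locintZ..].
Qed.

(** Here [p] is the end carrying the maximum and [q] the other one. With N = M / cos e and e > 0,
    all values satisfy v^2 < N strictly, and asin (M / N) = pi/2 - e, so the profile at [v p] is at
    least N^2 / 4 (pi/2 - e). The function [F] gathers the terms that depend on N, and e tends to 0
    from the right. *)
Lemma half_bound v g a b p q l M : a <= b ->
  locint g -> locint (fun x => g x ^+ 2) -> primitive v g -> continuous v ->
  (p, q) = (a, b) \/ (p, q) = (b, a) ->
  0 <= l -> 0 < M -> (forall x, a <= x <= b -> v x ^+ 2 <= M) -> v p ^+ 2 = M ->
  l * (pi / 4) * M ^+ 2 - 2 * l * M * v q ^+ 2 <=
  \I[a, b] (fun x => g x ^+ 2) +
    l ^+ 2 * (M ^+ 2 * \I[a, b] (fun x => v x ^+ 2) - \I[a, b] (fun x => v x ^+ 6)).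
Proof.
move=> ab gi g2i vg cv pq l0 M0 vM vpM.
set A := \I[a, b] _; set B := \I[a, b] _; set C := \I[a, b] _.
pose N (e : R) := M / cos e.
pose F e := 2 * l * (N e ^+ 2 / 4 * (pi / 2 - e) - N e * v q ^+ 2) - l ^+ 2 * N e ^+ 2 * B.
suff FAC : F 0 <= A - l ^+ 2 * C.
  by move: FAC; rewrite /F /N cos0 divr1; lra.
have cN : N e @[e --> 0^'+] --> N 0.
  apply: cvg_at_right_filter; apply: cvgM; first exact: cvg_cst.
  apply: cvgV; first by rewrite cos0 oner_neq0.
  exact: continuous_cos.
have cN2 : N e ^+ 2 @[e --> 0^'+] --> N 0 ^+ 2.
  by rewrite (_ : (fun e => _) = N \* N); [exact: cvgM | apply/funext => e; rewrite expr2].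
have ce : (e : R) @[e --> (0:R)^'+] --> (0 : R) by apply: cvg_at_right_filter; exact: cvg_id.
have cF : F e @[e --> 0^'+] --> F 0.
  apply: cvgB; apply: cvgM; [exact: cvg_cst| |exact: cvgM (cvg_cst _) cN2|exact: cvg_cst].
  apply: cvgB; apply: cvgM; [|apply: cvgB; [exact: cvg_cst|exact: ce]|exact: cN|exact: cvg_cst].
  by apply: cvgM; [exact: cN2|exact: cvg_cst].
apply: (cvgr_to_le cF).
have pi0 := pi_gt0 R.
have sin_co (e : R) : sin (pi / 2 - e) = cos e by rewrite addrC sinDpihalf cosN.
have cos_co (e : R) : cos (pi / 2 - e) = sin e by rewrite addrC cosDpihalf sinN opprK.
near=> e.
have e0 : 0 < e by [].
have epi : e < pi / 2 by near: e; apply: nbhs_right_lt; lra.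
have cose : 0 < cos e by apply: cos_gt0_pihalf; lra.
have cose1 : cos e < 1 by rewrite -cos0 ltr_cos ?in_itv/=; lra.
have N0 : 0 < N e by rewrite divr_gt0.
have MN : M < N e by rewrite /N ltr_pdivlMr// gtr_pMr.
have vN x : a <= x <= b -> v x ^+ 2 < N e by move=> /vM h; exact: (le_lt_trans h MN).
have [pab qab] : (a <= p <= b) /\ (a <= q <= b) by case: pq => -[-> ->]; rewrite !lexx !ab.
have Pp : N e ^+ 2 / 4 * (pi / 2 - e) <= profile (N e) (v p).
  rewrite /profile vpM (_ : M / N e = sin (pi / 2 - e)); last first.
    by rewrite sin_co /N; field; lra.
  rewrite sinK ?in_itv/=; last lra.
  rewrite ler_wpM2l//; first by rewrite divr_ge0// sqr_ge0.
  rewrite lerDl mulr_ge0// ?sin_co ?cos_co ?(ltW cose)//.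
  by apply: sin_ge0_pi; lra.
have Pq := profile_le N0 (vN q qab).
(* Young's inequality holds for either sign of [k]: [l] serves when the maximum is at the right end,
   [- l] when it is at the left. *)
have Y k : 2 * k * (profile (N e) (v b) - profile (N e) (v a)) <=
    A + k ^+ 2 * (N e ^+ 2 * B - C).
  rewrite -segment_integral_energy//.
  apply: (@young_segment _ v g (profile (N e)) (fun s => s ^+ 2 * (N e ^+ 2 - s ^+ 4))) => //.
    move=> x; apply: cvgM; first exact: exprn_continuous.
    by apply: cvgB; [exact: cvg_cst|exact: exprn_continuous].
  by move=> x y xab yab; apply: profile_MVT => //; exact: vN.
have YY : 2 * l * (profile (N e) (v p) - profile (N e) (v q)) <=
    A + l ^+ 2 * (N e ^+ 2 * B - C).
  case: pq => -[-> ->]; last exact: Y.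
  by have := Y (- l); rewrite sqrrN; lra.
have : l * (N e ^+ 2 / 4 * (pi / 2 - e) - N e * v q ^+ 2) <=
  l * (profile (N e) (v p) - profile (N e) (v q)).
  by rewrite ler_wpM2l//; lra.
by rewrite /F; lra.
Unshelve. all: by end_near. Qed.

End half_bound.

(** * The strict inequality for mean-zero functions on [0,1] *)

Section interval_inequality.
Variable R : realType.
Notation mu := (@lebesgue_measure R).
Implicit Types (a b c l M x y : R) (v g : R -> R).

Lemma interval_inequality v g :
  locint g -> locint (fun x => g x ^+ 2) -> primitive v g -> continuous v ->
  \I[0, 1] v = 0 -> (exists2 z, 0 <= z <= 1 & v z != 0) ->
  pi ^+ 2 / 16 * \I[0, 1] (fun x => v x ^+ 6) <
  \I[0, 1] (fun x => g x ^+ 2) * (\I[0, 1] (fun x => v x ^+ 2)) ^+ 2.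
Proof.
move=> gi g2i vg cv v0 [z z01 vz].
have cv2 := continuousX (n := 2) cv.
have v2z : 0 < v z ^+ 2 by rewrite exprn_even_gt0.
set A := \I[_, _] (fun x => g x ^+ 2); set B := \I[_, _] (fun x => v x ^+ 2).
set C := \I[_, _] _.
have B0 : 0 < B.
  by apply: (@segment_integral_gt0 _ _ _ _ z) => // x _; exact: sqr_ge0.
have [|x1] := @EVT_max R (fun x => v x ^+ 2) 0 1 ler01.
  exact: continuous_subspaceT.
rewrite in_itv/= => x101 x1max.
pose M := v x1 ^+ 2.
have vM x : 0 <= x <= 1 -> v x ^+ 2 <= M by move=> x01; apply: x1max; rewrite in_itv.
have M0 : 0 < M by exact: lt_le_trans (vM _ z01).
(* Otherwise [v x1 * v] is nonnegative and positive at [x1], so its integral is positive, against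
   the zero mean. The zero is then found between [x1] and [x2], and strictness comes from the piece
   between the zero and [x2]. *)
have [x2 x201 vx2] : exists2 x2, 0 <= x2 <= 1 & v x1 * v x2 < 0.
  apply: contrapT => nx2.
  have cx : continuous (fun x => v x1 * v x).
    by move=> x; apply: cvgM; [exact: cvg_cst|exact: cv].
  have : 0 < \I[0, 1] (fun x => v x1 * v x).
    apply: (@segment_integral_gt0 _ _ _ _ x1) => //.
    by move=> x x01; rewrite leNgt; apply/negP => h; apply: nx2; exists x.
  by rewrite segment_integralZ; [rewrite v0 mulr0 ltxx|exact: continuous_locint].
pose l := pi / 4 / B.
have pi0 := pi_gt0 R.
have l0 : 0 < l by rewrite /l !divr_gt0.
pose k x := l ^+ 2 * (v x ^+ 2 * (M ^+ 2 - v x ^+ 4)).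
pose h x := g x ^+ 2 + k x.
have ck : continuous k.
  move=> x; apply: cvgM; first exact: cvg_cst.
  apply: cvgM; first exact: cv2.
  by apply: cvgB; [exact: cvg_cst|exact: (continuousX (n := 4) cv)].
have ki := continuous_locint ck.
have hi : locint h by exact: locintD g2i ki.
have M2v x : 0 <= x <= 1 -> v x ^+ 4 <= M ^+ 2.
  by move=> /vM vxM; have := sqr_ge0 (v x); rewrite -[4%N]/(2 * 2)%N exprM; nra.
have k0 x : 0 <= x <= 1 -> 0 <= k x.
  move=> x01; apply: mulr_ge0; first exact: sqr_ge0.
  by apply: mulr_ge0; rewrite ?sqr_ge0// subr_ge0 M2v.
have h0 x : 0 <= x <= 1 -> 0 <= h x.
  by move=> x01; rewrite addr_ge0 ?sqr_ge0// k0.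
have hI0 a b : 0 <= a -> b <= 1 -> 0 <= \I[a, b] h.
  by move=> a0 b1; apply: segment_integral_ge0 => x ?; apply: h0; lra.
have hIgt0 a b : 0 <= a -> a < b -> b <= 1 ->
    (v a = 0 /\ v x1 * v b < 0) \/ (v b = 0 /\ v x1 * v a < 0) -> 0 < \I[a, b] h.
  move=> a0 ab b1 vab.
  (* One of the two end values is 0, so [v y] is half of the other: it is nonzero and its square is
     at most M / 4, which makes [k y] positive. *)
  have [y yab vy] : exists2 y, a <= y <= b & v y = (v a + v b) / 2.
    have [||y] := @IVT R v a b ((v a + v b) / 2) (ltW ab).
    - exact: continuous_subspaceT.
    - by case: (leP (v a) (v b)) => ?; lra.
    - by rewrite in_itv => yab vy; exists y.
  have [vy0 vyM] : 0 < v y ^+ 2 /\ v y ^+ 2 < M.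
    have va := vM a; have vb := vM b; rewrite vy.
    case: vab => -[-> vx]; rewrite ?addr0 ?add0r exprMn.
      have : 0 < v b ^+ 2.
        by rewrite exprn_even_gt0//; apply: contraTneq vx => ->; rewrite mulr0 ltxx.
      have := vb; rewrite (ltW (le_lt_trans a0 ab)) b1 => /(_ isT); lra.
    have : 0 < v a ^+ 2.
        by rewrite exprn_even_gt0//; apply: contraTneq vx => ->; rewrite mulr0 ltxx.
    have := va; rewrite a0 (ltW (lt_le_trans ab b1)) => /(_ isT); lra.
  apply: (@lt_le_trans _ _ (\I[a, b] k)).
    apply: (@segment_integral_gt0 _ _ _ _ y) => //.
      by move=> x xab; apply: k0; lra.
    apply: mulr_gt0; first exact: exprn_gt0.
    apply: mulr_gt0 => //; rewrite subr_gt0 -[4%N]/(2 * 2)%N exprM.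
    by nra.
  apply: segment_integral_le => // x xab.
  by rewrite /h lerDr sqr_ge0.
have energy a b : a <= b -> 0 <= a -> b <= 1 ->
    (v a = 0 /\ b = x1) \/ (v b = 0 /\ a = x1) -> l * (pi / 4) * M ^+ 2 <= \I[a, b] h.
  move=> ab a0 b1 vab; rewrite /h /k segment_integral_energy//.
  have [p [q [pq vp vq]]] : exists p q,
      [/\ (p, q) = (a, b) \/ (p, q) = (b, a), v p ^+ 2 = M & v q = 0].
    by case: vab => -[v0' ->]; [exists x1, a|exists x1, b]; split => //; [right|left].
  have := @half_bound R v g a b p q l M ab gi g2i vg cv pq (ltW l0) M0 _ vp.
  rewrite vq expr0n/= mulr0 subr0; apply => x xab; apply: vM; lra.
have [x0 x0x vx0] : exists2 x0, Num.min x1 x2 <= x0 <= Num.max x1 x2 & v x0 = 0.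
  case/orP: (le_total x1 x2) => x12.
    have [||y] := @IVT R v x1 x2 0 x12; first exact: continuous_subspaceT.
      by case: (leP (v _) (v _)) => ?; nra.
    by rewrite in_itv => ? ?; exists y; rewrite ?(min_l x12) ?(max_r x12).
  have [||y] := @IVT R v x2 x1 0 x12; first exact: continuous_subspaceT.
    by case: (leP (v _) (v _)) => ?; nra.
  by rewrite in_itv => ? ?; exists y; rewrite ?(min_r x12) ?(max_l x12).
have x02 : x0 != x2 by apply: contraTneq vx2 => <-; rewrite vx0 mulr0 ltxx.
have strict : l * (pi / 4) * M ^+ 2 < \I[0, 1] h.
  move: x0x; case: (leP x1 x2) => x12 /andP[h1 h2].
    have x02' : x0 < x2 by rewrite lt_neqAle x02.
    rewrite (@segment_integral_cat _ _ _ x1)//; try lra.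
    rewrite (@segment_integral_cat _ _ x1 x0)//; try lra.
    rewrite (@segment_integral_cat _ _ x0 x2)//; try lra.
    have := hI0 0 x1; have := hI0 x2 1; have := hIgt0 x0 x2; have := energy x1 x0.
    move=> /(_ h1 _ _ (or_intror (conj vx0 erefl))) e1.
    move=> /(_ _ x02' _ (or_introl (conj vx0 vx2))) e2 e3 e4.
    have := e1 _ _; have := e2 _ _; have := e3 _ _; have := e4 _ _.
    lra.
  have x02' : x2 < x0 by rewrite lt_neqAle eq_sym x02.
  rewrite (@segment_integral_cat _ _ _ x2)//; try lra.
  rewrite (@segment_integral_cat _ _ x2 x0)//; try lra.
  rewrite (@segment_integral_cat _ _ x0 x1)//; try lra.
  have := hI0 0 x2; have := hI0 x1 1; have := hIgt0 x2 x0; have := energy x0 x1.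
  move=> /(_ h2 _ _ (or_introl (conj vx0 erefl))) e1.
  move=> /(_ _ x02' _ (or_intror (conj vx0 vx2))) e2 e3 e4.
  have := e1 _ _; have := e2 _ _; have := e3 _ _; have := e4 _ _.
  lra.
move: strict; rewrite /h /k segment_integral_energy// -/A -/B -/C => strict.
have lB : l * B = pi / 4 by rewrite /l; field; lra.
have AC : l ^+ 2 * C < A.
  have : l ^+ 2 * (M ^+ 2 * B - C) = l * (pi / 4) * M ^+ 2 - l ^+ 2 * C.
    by rewrite -lB; ring.
  lra.
have -> : pi ^+ 2 / 16 * C = l ^+ 2 * C * B ^+ 2.
  have -> : l ^+ 2 * C * B ^+ 2 = (l * B) ^+ 2 * C by ring.
  by rewrite lB; field.
by rewrite ltr_pM2r// exprn_gt0.
Qed.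

End interval_inequality.

(** * The inequality on the line, by truncation *)

Section line_inequality.
Variable R : realType.
Notation mu := (@lebesgue_measure R).
Implicit Types (a b c e l n M x y : R) (f v g : R -> R).

Lemma segment_integral_le_line f a b : mu.-integrable setT (EFin \o f) ->
  (forall x, 0 <= f x) -> \I[a, b] f <= Rintegral mu setT f.
Proof.
move=> fi f0; rewrite /Rintegral fine_le//.
- by apply: integrable_fin_num => //; exact: integrableS fi.
- exact: integrable_fin_num.
- apply: ge0_subset_integral => //; first exact: measurable_int fi.
  by move=> x _; rewrite lee_fin.
Qed.

(** Chebyshev: f > e on a segment of length B / e + 1 would give an integral of at least B + e. *)
Lemma integrable_small_point f n e : mu.-integrable setT (EFin \o f) ->
  (forall x, 0 <= f x) -> 0 < e -> (exists2 b, n <= b & f b <= e) /\ (exists2 a, a <= n & f a <= e).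
Proof.
move=> fi f0 e0; set B := Rintegral mu setT f.
have B0 : 0 <= B by exact: Rintegral_ge0.
have li := integrable_locint fi.
have ci : locint (fun=> e) by apply: continuous_locint => ?; exact: cvg_cst.
have Le : e * (B / e + 1) > B by rewrite mulrDr mulrC divfK ?gt_eqF//; lra.
have L0 : 0 <= B / e + 1 by rewrite addr_ge0// divr_ge0// ltW.
have key a b : a <= b -> b - a = B / e + 1 -> (forall x, a <= x <= b -> e <= f x) -> False.
  move=> ab abL h; have := segment_integral_le ci li h.
  rewrite segment_integral_cst// abL.
  have := segment_integral_le_line a b fi f0; rewrite -/B; lra.
split; apply: contrapT => nh.
  apply: (key n (n + (B / e + 1))) => [||x /andP[nx _]]; try lra.
  by rewrite leNgt; apply/negP => xe; apply: nh; exists x; lra.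
apply: (key (n - (B / e + 1)) n) => [||x /andP[_ nx]]; try lra.
by rewrite leNgt; apply/negP => xe; apply: nh; exists x; lra.
Qed.

(** This is 2 v v' <= v'^2 + v^2 integrated, as the case Phi(s) = s^2, l = 1/2 of [young_segment];
    the mean value point is the midpoint of the two values. *)
Lemma primitive_sqr_le v g a b : a <= b ->
  locint g -> locint (fun x => g x ^+ 2) -> primitive v g -> continuous v ->
  v b ^+ 2 - v a ^+ 2 <= \I[a, b] (fun x => g x ^+ 2) + \I[a, b] (fun x => v x ^+ 2).
Proof.
move=> ab gi g2i vg cv.
have v2i := continuous_locint (continuousX (n := 2) cv).
have := @young_segment _ v g (fun s => s ^+ 2) (fun s => 4 * s ^+ 2) a b 2^-1
  ab gi g2i vg cv _ _.
rewrite (_ : 2 * 2^-1 = 1 :> R) ?mul1r; last by field.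
move=> h; rewrite -segment_integralD//.
rewrite (@eq_segment_integral _ _ (fun x => g x ^+ 2 + 2^-1 ^+ 2 * (4 * v x ^+ 2))); last first.
  by move=> x _; field.
apply: h.
  by move=> x; apply: cvgM; [exact: cvg_cst|exact: exprn_continuous].
move=> x y _ _; exists ((v x + v y) / 2), (v x + v y).
by case: (leP (v x) (v y)) => ?; split; try lra; try ring;
  rewrite le_eqVlt; apply/orP; left; apply/eqP; field.
Qed.

(** Both sides of the maximum are handled by [half_bound] and added. The sixth power is integrated
    over [-n, n] only, because its integrability on the line is a consequence of this bound, which
    is uniform in [n]. *)
Lemma line_inequality v g n : 0 <= n ->
  locint g -> mu.-integrable setT (EFin \o (fun x => g x ^+ 2)) ->
  mu.-integrable setT (EFin \o (fun x => v x ^+ 2)) ->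
  primitive v g -> continuous v -> 0 < Rintegral mu setT (fun x => v x ^+ 2) ->
  pi ^+ 2 / 4 * \I[- n, n] (fun x => v x ^+ 6) <=
  Rintegral mu setT (fun x => g x ^+ 2) * Rintegral mu setT (fun x => v x ^+ 2) ^+ 2.
Proof.
move=> n0 gi g2T v2T vg cv B0.
have g2i := integrable_locint g2T.
have cv2 := continuousX (n := 2) cv.
have v2i := continuous_locint cv2.
have v6i := continuous_locint (continuousX (n := 6) cv).
have v60 x : 0 <= v x ^+ 6 by rewrite exprn_even_ge0.
have g20 x : 0 <= g x ^+ 2 by exact: sqr_ge0.
have v20 x : 0 <= v x ^+ 2 by exact: sqr_ge0.
set A := Rintegral mu setT (fun x => g x ^+ 2).
set B := Rintegral mu setT _ in B0 *; set C := \I[_, _] _.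
have A0 : 0 <= A by apply: Rintegral_ge0 => x _; exact: sqr_ge0.
have pi0 := pi_gt0 R.
pose l := pi / 2 / B; have l0 : 0 < l by rewrite /l !divr_gt0.
have lB : l * B = pi / 2 by rewrite /l; field; lra.
clearbody l.
(* The error gathers the losses 2 l M v^2 at the two ends, where v^2 <= e, using M <= e + A + B.
   That bound on M does not depend on the segment, so the error vanishes with [e]. *)
suff key e : 0 < e -> l ^+ 2 * C <= A + 4 * l * (e + A + B) * e.
  have lCA : l ^+ 2 * C <= A.
    apply/ler_addgt0Pr => e e0; set K := 4 * l * (1 + A + B).
    have K0 : 0 < K by rewrite /K !mulr_gt0//; lra.
    pose d := Num.min 1 (e / K).
    have d0 : 0 < d by rewrite lt_min ltr01 divr_gt0.
    have d1 : d <= 1 by rewrite ge_min lexx.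
    have dK : K * d <= e.
      have : d <= e / K by rewrite ge_min lexx orbT.
      by rewrite ler_pdivlMr// mulrC.
    apply: (le_trans (key d d0)); rewrite lerD2l; apply: le_trans dK.
    rewrite ler_wpM2r ?(ltW d0)// /K ler_wpM2l//; last lra.
    by rewrite mulr_ge0// ltW.
  have -> : pi ^+ 2 / 4 * C = l ^+ 2 * C * B ^+ 2.
    have -> : l ^+ 2 * C * B ^+ 2 = (l * B) ^+ 2 * C by ring.
    by rewrite lB; field.
  by rewrite ler_wpM2r// sqr_ge0.
move=> e0.
have [_ [a an va]] := integrable_small_point (- n) v2T v20 e0.
have [[b nb vb] _] := integrable_small_point n v2T v20 e0.
have ab : a <= b by lra.
have Cab : C <= \I[a, b] (fun x => v x ^+ 6).
  rewrite (@segment_integral_cat _ _ a (- n) b)//; last lra.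
  rewrite (@segment_integral_cat _ _ (- n) n b)//; last lra.
  have := @segment_integral_ge0 _ (fun x => v x ^+ 6) a (- n) (fun x _ => v60 x).
  have := @segment_integral_ge0 _ (fun x => v x ^+ 6) n b (fun x _ => v60 x).
  by rewrite -/C; lra.
have [|x1] := @EVT_max R (fun x => v x ^+ 2) a b ab; first exact: continuous_subspaceT.
rewrite in_itv/= => /andP[ax1 x1b] x1max.
set M := v x1 ^+ 2 in x1max.
have vM x : a <= x <= b -> v x ^+ 2 <= M by move=> ?; apply: x1max; rewrite in_itv.
have K0 : 0 <= 4 * l * (e + A + B) * e by rewrite !mulr_ge0//; lra.
(* [half_bound] asks for M > 0; if M = 0 then [v] vanishes on the whole segment. *)
have := sqr_ge0 (v x1); rewrite -/M le_eqVlt => /orP[/eqP M0|M0].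
  have : \I[a, b] (fun x => v x ^+ 6) <= 0.
    rewrite -(mul0r (b - a)) -segment_integral_cst//.
    apply: segment_integral_le => //.
      by apply: continuous_locint => ?; exact: cvg_cst.
    move=> x /vM; rewrite -M0 => vx; rewrite -[6%N]/(2 * 3)%N exprM.
    by have -> : v x ^+ 2 = 0; [apply/le_anti; rewrite vx v20|rewrite expr0n].
  move=> C0; have : l ^+ 2 * C <= 0 by rewrite mulr_ge0_le0 ?sqr_ge0//; lra.
  lra.
have MAB : M <= e + A + B.
  have := primitive_sqr_le ax1 gi g2i vg cv.
  have := segment_integral_le_line a x1 g2T g20; have := segment_integral_le_line a x1 v2T v20.
  rewrite -/A -/B -/M; lra.
have h1 := @half_bound R v g a x1 x1 a l M ax1 gi g2i vg cv (or_intror erefl) (ltW l0) M0 _ erefl.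
have h2 := @half_bound R v g x1 b x1 b l M x1b gi g2i vg cv (or_introl erefl) (ltW l0) M0 _ erefl.
have A1 := segment_integral_le_line a b g2T g20.
have B1 := segment_integral_le_line a b v2T v20.
move: Cab A1 B1; rewrite -/A -/B.
rewrite !(@segment_integral_cat _ _ a x1 b)//.
set A1 := \I[a, x1] _ in h1 *; set A2 := \I[x1, b] _ in h2 *.
set B1 := \I[a, x1] _ in h1 *; set B2 := \I[x1, b] _ in h2 *.
set C1 := \I[a, x1] _ in h1 *; set C2 := \I[x1, b] _ in h2 *.
move=> hC hA hB.
have {}h1 : l * (pi / 4) * M ^+ 2 - 2 * l * M * v a ^+ 2 <= A1 + l ^+ 2 * (M ^+ 2 * B1 - C1).
  by apply: h1 => x xab; apply: vM; lra.
have {}h2 : l * (pi / 4) * M ^+ 2 - 2 * l * M * v b ^+ 2 <= A2 + l ^+ 2 * (M ^+ 2 * B2 - C2).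
  by apply: h2 => x xab; apply: vM; lra.
have lM : 0 <= l * M by rewrite mulr_ge0 ?ltW.
have e1 : l * M * v a ^+ 2 <= l * M * e by rewrite ler_wpM2l.
have e2 : l * M * v b ^+ 2 <= l * M * e by rewrite ler_wpM2l.
have e3 : l * M * e <= l * (e + A + B) * e.
  by rewrite ler_wpM2r ?(ltW e0)// ler_wpM2l// ltW.
have e4 : l ^+ 2 * C <= l ^+ 2 * (C1 + C2) by rewrite ler_wpM2l ?sqr_ge0.
have e5 : l ^+ 2 * M ^+ 2 * (B1 + B2) <= l ^+ 2 * M ^+ 2 * B.
  by rewrite ler_wpM2l// mulr_ge0// sqr_ge0.
have e6 : l ^+ 2 * M ^+ 2 * B = l * (pi / 2) * M ^+ 2 by rewrite -lB; ring.
lra.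
Qed.

End line_inequality.

(** * Passing from almost-everywhere classes to continuous representatives *)

Section transfer.
Variable R : realType.
Notation mu := (@lebesgue_measure R).
Implicit Types (a b c x y : R) (f u v g F : R -> R).

Lemma primitive_continuous v g : locint g -> primitive v g -> continuous v.
Proof.
move=> gi vg x.
have lt : x - 1 < x + 1 by lra.
have := @parameterized_integral_continuous R (x - 1) (x + 1) g (ltW lt) (gi _ _).
move=> /(continuous_within_itvP _ lt)[+ _ _].
have xin : x \in `](x - 1), (x + 1)[ by rewrite in_itv/=; lra.
move=> /(_ x xin) cI.
pose V y := v (x - 1) + parameterized_integral mu (x - 1) y g.
have cV : V y @[y --> x] --> V x by apply: cvgD => //; exact: cvg_cst.
have e : {in `](x - 1), (x + 1)[, v =1 V}.
  by move=> y; rewrite in_itv/= => /andP[/ltW xy _];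
    rewrite /V /parameterized_integral -(vg _ _ xy); ring.
rewrite /continuous_at (e x xin); apply: cvg_trans cV.
apply: near_eq_cvg; have := near_in_itvoo xin; apply: filterS => y yin.
by rewrite e.
Qed.

Lemma primitive_sint c g : locint g -> primitive (fun x => c + sint 0 x g) g.
Proof.
move=> gi x y xy; rewrite /sint.
have [x0|x0] := leP 0 x; have [y0|y0] := leP 0 y; try lra.
- by rewrite (segment_integral_cat gi x0 xy); ring.
- by rewrite (segment_integral_cat gi (ltW x0) y0); ring.
- by rewrite (segment_integral_cat gi xy (ltW y0)); ring.
Qed.

Lemma primitive_addr v g c : primitive v g -> primitive (fun x => v x + c) g.
Proof. by move=> vg x y xy; rewrite -vg//; ring. Qed.

Lemma ae_imply (P Q : R -> Prop) : (forall x, P x -> Q x) ->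
  {ae mu, forall x, P x} -> {ae mu, forall x, Q x}.
Proof.
move=> PQ; have F : Filter (nbhs (almost_everywhere mu)) by exact: _.
exact: (@filterS _ _ F).
Qed.

Lemma segment_integral_EFin f a b : locint f ->
  (\int[mu]_(x in `[a, b]) (f x)%:E)%E = (\I[a, b] f)%:E.
Proof. by move=> fi; rewrite /Rintegral fineK//; exact: integrable_fin_num. Qed.

Lemma ae_eq_integral_comp (D : set R) u v F : measurable D ->
  measurable_fun D u -> continuous v -> continuous F ->
  {ae mu, forall x, D x -> u x = v x} ->
  (\int[mu]_(x in D) (F (u x))%:E = \int[mu]_(x in D) (F (v x))%:E)%E.
Proof.
move=> mD mD_u cv cF uv; apply: ae_eq_integral => //.
- apply/measurable_EFinP; apply: measurableT_comp => //.
  exact: continuous_measurable_fun.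
- apply/measurable_EFinP; apply: measurableT_comp.
    exact: continuous_measurable_fun.
  by apply: measurable_funTS; exact: continuous_measurable_fun.
- by apply: ae_imply uv => x uv Dx; rewrite uv.
Qed.

Lemma EFin_quot a b c : 0 < c ->
  (a%:E * b%:E ^+ 2 / c%:E)%E = (a * b ^+ 2 / c)%:E.
Proof. by move=> c0; rewrite inver gt_eqF// expe2 -!EFinM expr2. Qed.

(** Monotone convergence along [-n, n]; finiteness of the full integral is part of the
    conclusion. *)
Lemma integral_line_le f (K : R) : continuous f -> (forall x, 0 <= f x) ->
  (forall n : nat, \I[- n%:R, n%:R] f <= K) -> (\int[mu]_x (f x)%:E <= K%:E)%E.
Proof.
move=> cf f0 fK; pose F (n : nat) : set R := `[- n%:R, n%:R]%classic.
have bigF : \bigcup_n F n = setT.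
  apply/seteqP; split => // x _.
  exists (Num.bound `|x|) => //; rewrite /F/= in_itv/= -ler_norml.
  exact/ltW/archi_boundP.
rewrite -bigF.
have cF : (\int[mu]_(x in F n) (f x)%:E @[n --> \oo] -->
    \int[mu]_(x in \bigcup_n F n) (f x)%:E)%E.
  apply: ge0_nondecreasing_set_cvg_integral => //.
  - move=> n m nm; apply/subsetPset => x; rewrite /F/= !in_itv/=.
    have : n%:R <= m%:R :> R by rewrite ler_nat.
    by move=> ? ?; lra.
  - by move=> n; exact: measurable_itv.
  - by move=> n; apply: (measurable_int mu); exact: (continuous_locint cf).
  - by move=> n x _; rewrite lee_fin.
rewrite -(cvg_lim _ cF)//; apply: lime_le; first by apply/cvg_ex; eexists; exact: cF.
by apply: nearW => n; rewrite segment_integral_EFin ?lee_fin//; exact: continuous_locint.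
Qed.

End transfer.

(** * Lower bounds for the two quotients *)

Section lower_bounds.
Variable R : realType.
Notation mu := (@lebesgue_measure R).

Lemma quotI_gt (u g : R -> R) : W11I u g -> nonconstI u ->
  ((pi ^+ 2 / 16 : R)%:E < quotI u g)%E.
Proof.
move=> [mu_u [mg [gi [c uE]]]] nc.
(* Extension of [g] by zero, so that [v] is a primitive on the whole line as the segment lemmas
   expect. *)
pose g0 : R -> R := g \_ (@I01 R).
have mI : measurable (@I01 R) by exact: measurable_itv.
have locpatch (f : R -> R) : mu.-integrable (@I01 R) (EFin \o f) -> locint (f \_ (@I01 R)).
  move=> fi; apply: integrable_locint.
  by rewrite -restrict_EFin; apply: (@integrable_mkcond _ _ R mu _ (EFin \o f) _).1 fi.
have g0i : locint g0 by exact: locpatch.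
have g0E x : 0 <= x <= 1 -> g0 x = g x.
  by move=> x01; rewrite /g0 patchE mem_set//= /I01/= in_itv.
pose v x := c + sint 0 x g0.
have vg : primitive v g0 by exact: primitive_sint.
have cv := primitive_continuous g0i vg.
have uv : {ae mu, forall x, @I01 R x -> u x = v x}.
  apply: ae_imply uE => x uE xI; rewrite uE ?mem_set// /v /sint.
  move: xI; rewrite /I01/= in_itv/= => /andP[x0 x1]; rewrite x0; congr (_ + _).
  by apply: eq_segment_integral => y /andP[y0 yx]; rewrite g0E// y0 (le_trans yx).
set m := meanI u.
have mE : m = \I[0, 1] v.
  by rewrite /m /meanI /Rintegral; congr fine;
    apply: (@ae_eq_integral_comp R (@I01 R) u v id) => // x; exact: cvg_id.
pose w x := v x + - m.
have wg : primitive w g0 by exact: primitive_addr.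
have cw := primitive_continuous g0i wg.
have ci (k : R) : locint (fun=> k) by apply: continuous_locint => ?; exact: cvg_cst.
have wi := continuous_locint cw.
have w2i := continuous_locint (continuousX (n := 2) cw).
have w6i := continuous_locint (continuousX (n := 6) cw).
have v2i := continuous_locint (continuousX (n := 2) cv).
have w0 : \I[0, 1] w = 0.
  rewrite segment_integralD//; last exact: continuous_locint.
  by rewrite segment_integral_cst// -mE; ring.
have [z z01 wz] : exists2 z, 0 <= z <= 1 & w z != 0.
  apply: contrapT => nz; apply: nc; exists m; apply: ae_imply uv => x uv xI.
  have {}xI := set_mem xI; rewrite (uv xI); apply/eqP; rewrite -subr_eq0; apply/negPn/negP => h.
  by apply: nz; exists x => //; move: xI; rewrite /I01/= in_itv.
have B0 : 0 < \I[0, 1] (fun x => w x ^+ 2).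
  apply: (@segment_integral_gt0 _ _ _ _ z) => //; first exact: (continuousX (n := 2) cw).
    by move=> x _; exact: sqr_ge0.
  by rewrite exprn_even_gt0.
have C0 : 0 < \I[0, 1] (fun x => w x ^+ 6).
  apply: (@segment_integral_gt0 _ _ _ _ z) => //; first exact: (continuousX (n := 6) cw).
    by move=> x _; exact: exprn_even_ge0.
  by rewrite exprn_even_gt0.
(* The cross term vanishes because [w] has mean zero; replacing [v] by [w] in the numerator
   therefore only lowers the quotient. *)
have BE : \I[0, 1] (fun x => v x ^+ 2) = \I[0, 1] (fun x => w x ^+ 2) + m ^+ 2.
  transitivity (\I[0, 1] (fun x => w x ^+ 2 + (2 * m * w x + m ^+ 2))).
    by apply: eq_segment_integral => x _; rewrite /w; ring.
  rewrite segment_integralD//; last by apply: locintD => //; exact: locintZ.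
  rewrite segment_integralD//; last exact: locintZ.
  by rewrite segment_integralZ// w0 segment_integral_cst//; ring.
rewrite /quotI -/m.
rewrite (@ae_eq_integral_comp _ _ u v (fun s => s ^+ 2))//; last exact: exprn_continuous.
rewrite (@ae_eq_integral_comp _ _ u v (fun s => `|s - m| ^+ 6))//; last first.
  apply: continuousX => x; apply: cvg_norm.
  by apply: cvgB; [exact: cvg_id|exact: cvg_cst].
rewrite (_ : (\int[mu]_(x in @I01 R) (`|v x - m| ^+ 6)%:E)%E =
    (\I[0, 1] (fun x => w x ^+ 6))%:E); last first.
  rewrite -segment_integral_EFin//; apply: eq_integral => x _.
  by congr EFin; rewrite -normrX ger0_norm// exprn_even_ge0.
rewrite [in X in (_ < _ * X / _)%E]segment_integral_EFin//.
(* Membership in W^{1,1} leaves open whether [g] is in L^2. If it is not, the quotient is +oo, the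
   other two integrals being finite and positive. *)
have [g2I|ng2I] := pselect (mu.-integrable (@I01 R) (EFin \o (fun x => g x ^+ 2))).
  have g02i : locint (fun x => g0 x ^+ 2).
    have := locpatch _ g2I; congr locint; apply/funext => x.
    by rewrite /g0 !patchE; case: ifP => // _; rewrite expr0n.
  rewrite (_ : (\int[mu]_(x in @I01 R) (g x ^+ 2)%:E)%E =
      (\I[0, 1] (fun x => g0 x ^+ 2))%:E); last first.
    rewrite -segment_integral_EFin//; apply: eq_integral => x.
    by rewrite inE /I01/= in_itv/= => x01; rewrite g0E.
  rewrite EFin_quot// lte_fin ltr_pdivlMr//.
  apply: (lt_le_trans (interval_inequality g0i g02i wg cw w0 _)); first by exists z.
  rewrite ler_wpM2l//; first by apply: segment_integral_ge0 => x _; exact: sqr_ge0.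
  by rewrite ler_pXn2r ?nnegrE ?BE//; have := sqr_ge0 m; lra.
have -> : (\int[mu]_(x in @I01 R) (g x ^+ 2)%:E)%E = +oo%E.
  apply/eqP; rewrite eq_le leey/= leNgt; apply/negP => gfin; apply: ng2I.
  apply/integrableP; split.
    by apply/measurable_EFinP; exact: measurable_funX.
  rewrite (le_lt_trans _ gfin)// le_eqVlt; apply/orP; left; apply/eqP.
  by apply: eq_integral => x _ /=; rewrite ger0_norm// sqr_ge0.
have v20 : 0 < \I[0, 1] (fun x => v x ^+ 2) by rewrite BE; have := sqr_ge0 m; lra.
by rewrite inver gt_eqF// expe2 -EFinM !gt0_mulye ?ltey ?lte_fin ?mulr_gt0 ?invr_gt0.
Qed.

Lemma quotR_ge (u g : R -> R) : H1R u g -> ~ {ae mu, forall x, u x = 0} ->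
  ((pi ^+ 2 / 4 : R)%:E <= quotR u g)%E.
Proof.
move=> [mu_u [mg [u2i [g2i [c uE]]]]] nz.
have zlt (z : R) : z - 1 < z + 1 by lra.
have zin (z : R) : z - 1 <= z <= z + 1 by lra.
(* Local integrability comes from |g| <= 1 + g^2. *)
have gi : locint g.
  move=> a b; apply: (@le_integrable _ _ R mu `[a, b]%classic _ (EFin \o g)
    (EFin \o (fun x => 1 + g x ^+ 2))) => //.
  - by apply/measurable_EFinP; exact: measurable_funTS.
  - move=> x _; rewrite /= lee_fin (ger0_norm (addr_ge0 ler01 (sqr_ge0 _))).
    by rewrite -[g x ^+ 2]real_normK ?num_real//; have := sqr_ge0 (`|g x| - 1); nra.
  - apply: (locintD _ (integrable_locint g2i)).
    by apply: continuous_locint => ?; exact: cvg_cst.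
pose v x := c + sint 0 x g.
have vg : primitive v g by exact: primitive_sint.
have cv := primitive_continuous gi vg.
have uv : {ae mu, forall x, [set: R] x -> u x = v x} by apply: ae_imply uE.
have E2 := @ae_eq_integral_comp _ _ u v (fun s => s ^+ 2) measurableT mu_u cv
  (@exprn_continuous _ 2) uv.
have E6 := @ae_eq_integral_comp _ _ u v (fun s => s ^+ 6) measurableT mu_u cv
  (@exprn_continuous _ 6) uv.
have mvn n : measurable_fun setT (EFin \o (fun x => v x ^+ n)).
  by apply/measurable_EFinP; apply: continuous_measurable_fun; exact: continuousX.
have normE n (f : R -> R) : (forall x, 0 <= f x ^+ n) ->
    (\int[mu]_x `|(f x ^+ n)%:E| = \int[mu]_x (f x ^+ n)%:E)%E.
  by move=> f0; apply: eq_integral => x _ /=; rewrite ger0_norm.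
have v2i : mu.-integrable setT (EFin \o (fun x => v x ^+ 2)).
  apply/integrableP; split; first exact: mvn.
  move/integrableP : u2i => [_ h]; apply: (le_lt_trans _ h).
  rewrite le_eqVlt; apply/orP; left; apply/eqP.
  transitivity (\int[mu]_x (v x ^+ 2)%:E)%E.
    by apply: (normE 2%N v) => x; exact: sqr_ge0.
  by rewrite -E2; symmetry; apply: (normE 2%N u) => x; exact: sqr_ge0.
have [z vz] : exists z, v z != 0.
  apply: contrapT => nv; apply: nz; apply: ae_imply uE => x ->.
  by apply/eqP/negPn/negP => h; apply: nv; exists x.
have loc_gt0 n : ~~ odd n -> 0 < \I[z - 1, z + 1] (fun x => v x ^+ n).
  move=> on; apply: (segment_integral_gt0 (zlt z) _ _ (zin z)).
  - exact: continuousX.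
  - by move=> x _; exact: exprn_even_ge0.
  - by rewrite exprn_even_gt0// vz orbT.
have B0 : 0 < Rintegral mu setT (fun x => v x ^+ 2).
  apply: (lt_le_trans (loc_gt0 2%N isT)); apply: segment_integral_le_line => // x.
  exact: sqr_ge0.
pose A := Rintegral mu setT (fun x => g x ^+ 2).
pose B := Rintegral mu setT (fun x => v x ^+ 2).
have pi0 := pi_gt0 R.
(* This shows that the denominator is finite, which [H1R] does not state; with [C0] the quotient
   becomes one of real numbers. *)
have Cle : (\int[mu]_x (v x ^+ 6)%:E <= (A * B ^+ 2 / (pi ^+ 2 / 4))%:E)%E.
  apply: integral_line_le => [|x|n]; [exact: continuousX|exact: exprn_even_ge0|].
  rewrite ler_pdivlMr ?divr_gt0 ?exprn_gt0// mulrC.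
  exact: line_inequality.
have C0 : (0 < \int[mu]_x (v x ^+ 6)%:E)%E.
  apply: (@lt_le_trans _ _ (\I[z - 1, z + 1] (fun x => v x ^+ 6))%:E).
    by rewrite lte_fin loc_gt0.
  rewrite -segment_integral_EFin; last exact/continuous_locint/continuousX.
  apply: ge0_subset_integral => //; first exact: (mvn 6%N).
  by move=> x _; rewrite lee_fin exprn_even_ge0.
have AE : (\int[mu]_x (g x ^+ 2)%:E)%E = A%:E.
  by rewrite /A /Rintegral fineK//; exact: (integrable_fin_num measurableT g2i).
have BE : (\int[mu]_x (v x ^+ 2)%:E)%E = B%:E.
  by rewrite /B /Rintegral fineK//; exact: (integrable_fin_num measurableT v2i).
rewrite /quotR E2 E6 AE BE.
case: (\int[mu]_x (v x ^+ 6)%:E)%E C0 Cle => // C; rewrite lte_fin lee_fin => C0 Cle.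
rewrite EFin_quot// lee_fin ler_pdivlMr// mulrC -ler_pdivlMr//.
by rewrite divr_gt0 ?exprn_gt0.
Qed.

End lower_bounds.

(** * The extremal profile and its explicit integrals *)

Section soliton.
Variable R : realType.
Notation mu := (@lebesgue_measure R).
Implicit Types (k x y : R).

Lemma is_derive_continuous (F : R -> R) x d : is_derive x 1 F d -> {for x, continuous F}.
Proof. by case=> dF _; exact/differentiable_continuous/derivable1_diffP. Qed.

Lemma antiderivative_primitive (F f : R -> R) :
  continuous f -> (forall x, is_derive x 1 F (f x)) -> primitive F f.
Proof.
move=> cf dF x y; rewrite le_eqVlt => /orP[/eqP ->|xy].
  by rewrite subrr set_itv1 Rintegral_set1.
have cF : continuous F.
  by move=> z; exact: is_derive_continuous (dF z).
rewrite /Rintegral (@continuous_FTC2 _ f F)//.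
- exact: continuous_subspaceT.
- split => [z _||]; first by case: (dF z).
    exact/cvg_at_right_filter/cF.
  exact/cvg_at_left_filter/cF.
- by move=> z _; rewrite derive1E; case: (dF z).
Qed.

Definition cosh x : R := (expR x + expR (- x)) / 2.
Definition sinh x : R := (expR x - expR (- x)) / 2.

Lemma is_derive_cosh x : is_derive x 1 cosh (sinh x).
Proof. by rewrite /cosh /sinh; apply: is_derive_eq; rewrite /GRing.scale/=; field. Qed.

Lemma is_derive_sinh x : is_derive x 1 sinh (cosh x).
Proof. by rewrite /cosh /sinh; apply: is_derive_eq; rewrite /GRing.scale/=; field. Qed.

Lemma cosh_sqr x : cosh x ^+ 2 = 1 + sinh x ^+ 2.
Proof.
have : expR x * expR (- x) = 1 by rewrite -expRD subrr expR0.
by rewrite /cosh /sinh => e; lra.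
Qed.

Lemma cosh_gt0 x : 0 < cosh x.
Proof. by rewrite divr_gt0// addr_gt0// expR_gt0. Qed.

Lemma cosh_ge1 x : 1 <= cosh x.
Proof. by have := cosh_sqr x; have := sqr_ge0 (sinh x); have := cosh_gt0 x; nra. Qed.

Lemma sinh_ge x : 0 <= x -> x / 2 <= sinh x.
Proof.
move=> x0; rewrite /sinh ler_pM2r//.
have := expR_ge1Dx x; have : expR (- x) <= 1 by rewrite -expR0 ler_expR; lra.
lra.
Qed.

Definition soliton k x := (Num.sqrt (cosh (2 * k * x)))^-1.
Definition soliton' k x :=
  - (k * sinh (2 * k * x)) / (cosh (2 * k * x) * Num.sqrt (cosh (2 * k * x))).
(** The Gudermannian function atan (sinh y) is an antiderivative of 1 / cosh y. *)
Definition soliton2_prim k x := atan (sinh (2 * k * x)) / (2 * k).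
(** From the antiderivative (sinh y / cosh^2 y + atan (sinh y)) / 2 of 1 / cosh^3 y, with y = 2 k
    x. *)
Definition soliton6_prim k x :=
  (sinh (2 * k * x) / cosh (2 * k * x) ^+ 2 + atan (sinh (2 * k * x))) / (4 * k).

Lemma sqrt_cosh k x : Num.sqrt (cosh (2 * k * x)) ^+ 2 = cosh (2 * k * x).
Proof. by rewrite sqr_sqrtr// ltW// cosh_gt0. Qed.

Lemma soliton2 k x : soliton k x ^+ 2 = (cosh (2 * k * x))^-1.
Proof. by rewrite /soliton exprVn sqrt_cosh. Qed.

Lemma soliton6 k x : soliton k x ^+ 6 = (cosh (2 * k * x)) ^- 3.
Proof. by rewrite -[6%N]/(2 * 3)%N exprM soliton2 exprVn. Qed.

(** The equality case of Young's inequality for M = 1 and l = k. It also gives the Dirichlet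
    integral from the other two. *)
Lemma soliton'2 k x : soliton' k x ^+ 2 = k ^+ 2 * (soliton k x ^+ 2 - soliton k x ^+ 6).
Proof.
have c0 := cosh_gt0 (2 * k * x).
have := sqrt_cosh k x; have := cosh_sqr (2 * k * x).
rewrite soliton2 soliton6 /soliton'.
have : 0 < Num.sqrt (cosh (2 * k * x)) by rewrite sqrtr_gt0.
move: c0; move: (Num.sqrt (cosh _)) => q.
move: (cosh _) (sinh _) => c s c0 q0 cs qc.
have -> : (- (k * s) / (c * q)) ^+ 2 = k ^+ 2 * (1 + s ^+ 2 - 1) / (c ^+ 2 * q ^+ 2).
  by field; lra.
by rewrite -cs qc; field; lra.
Qed.

Lemma soliton_gt0 k x : 0 < soliton k x.
Proof. by rewrite invr_gt0 sqrtr_gt0 cosh_gt0. Qed.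

Lemma soliton_le1 k x : soliton k x <= 1.
Proof.
rewrite -(ler_pXn2r (n := 2)) ?nnegrE ?(ltW (soliton_gt0 k x))// expr1n soliton2.
by rewrite invf_le1 ?cosh_gt0 ?cosh_ge1.
Qed.

Lemma is_derive_scale2 k x : is_derive x 1 (fun x => 2 * k * x) (2 * k).
Proof. by apply: is_derive_eq; rewrite /GRing.scale/= mulr1. Qed.

Lemma is_derive_cosh2 k x :
  is_derive x 1 (fun x => cosh (2 * k * x)) (2 * k * sinh (2 * k * x)).
Proof.
rewrite (mulrC (2 * k) (sinh _)).
exact: (is_derive1_comp (is_derive_cosh (2 * k * x)) (is_derive_scale2 k x)).
Qed.

Lemma is_derive_sinh2 k x :
  is_derive x 1 (fun x => sinh (2 * k * x)) (2 * k * cosh (2 * k * x)).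
Proof.
rewrite (mulrC (2 * k) (cosh _)).
exact: (is_derive1_comp (is_derive_sinh (2 * k * x)) (is_derive_scale2 k x)).
Qed.

Lemma is_derive_soliton k x : is_derive x 1 (soliton k) (soliton' k x).
Proof.
have c0 := cosh_gt0 (2 * k * x).
have s0 : Num.sqrt (cosh (2 * k * x)) != 0 by rewrite gt_eqF// sqrtr_gt0.
have ds := @is_derive1_comp R Num.sqrt (fun x => cosh (2 * k * x)) x _ _
  (is_derive1_sqrt c0) (is_derive_cosh2 k x).
have dV := @is_deriveV R (Num.sqrt \o (fun x => cosh (2 * k * x))) x _ 1 s0 ds.
apply: (is_derive_eq dV); rewrite /GRing.scale/= /soliton'.
move: s0 (sqrt_cosh k x) c0; move: (Num.sqrt (cosh _)) => q.
by move: (cosh _) (sinh _) => c s q0 <- c0; field.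
Qed.

Lemma is_derive_atan_sinh2 k x : is_derive x 1 (fun x => atan (sinh (2 * k * x)))
  (2 * k * (cosh (2 * k * x))^-1).
Proof.
have c0 := cosh_gt0 (2 * k * x).
have da := @is_derive1_comp R (@atan R) (fun x => sinh (2 * k * x)) x _ _
  (is_derive1_atan _) (is_derive_sinh2 k x).
apply: (is_derive_eq da); rewrite -cosh_sqr.
by move: (cosh _) c0 => c c0; field; lra.
Qed.

Lemma is_derive_soliton2_prim k x : k != 0 ->
  is_derive x 1 (soliton2_prim k) (soliton k x ^+ 2).
Proof.
move=> k0; have c0 := cosh_gt0 (2 * k * x).
have da := is_derive_atan_sinh2 k x.
rewrite /soliton2_prim soliton2; apply: is_derive_eq.
rewrite /GRing.scale/=.
by move: (cosh _) c0 => c c0; field; rewrite k0/=; lra.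
Qed.

Lemma is_derive_soliton6_prim k x : k != 0 ->
  is_derive x 1 (soliton6_prim k) (soliton k x ^+ 6).
Proof.
move=> k0; have c0 := cosh_gt0 (2 * k * x).
have da := is_derive_atan_sinh2 k x.
have dc := is_derive_cosh2 k x.
have ds := is_derive_sinh2 k x.
have c20 : cosh (2 * k * x) ^+ 2 != 0 by rewrite expf_neq0// gt_eqF.
have dV := @is_deriveV R (fun x => cosh (2 * k * x) ^+ 2) x _ 1 c20 (is_deriveX 2 dc).
rewrite /soliton6_prim soliton6.
have -> : (fun x => (sinh (2 * k * x) / cosh (2 * k * x) ^+ 2 +
    atan (sinh (2 * k * x))) / (4 * k)) =
  (4 * k)^-1 *: ((fun x => sinh (2 * k * x)) * (fun x => (cosh (2 * k * x) ^+ 2)^-1) +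
    (fun x => atan (sinh (2 * k * x)))).
  by apply/funext => y /=; rewrite /GRing.scale/= mulrC.
apply: (is_derive_eq (is_deriveZ _ (is_deriveD (is_deriveM ds dV) da))).
rewrite /GRing.scale/=; move: c0 (cosh_sqr (2 * k * x)).
move: (cosh _) (sinh _) => c s c0 cs.
transitivity ((c ^+ 2 - s ^+ 2) / c ^+ 3); first by field; rewrite k0/=; lra.
by rewrite cs addrK mul1r.
Qed.

Lemma continuous_cosh2 k : continuous (fun x => cosh (2 * k * x)).
Proof.
by move=> x; exact: is_derive_continuous (is_derive_cosh2 k x).
Qed.

Lemma continuous_sinh2 k : continuous (fun x => sinh (2 * k * x)).
Proof.
by move=> x; exact: is_derive_continuous (is_derive_sinh2 k x).
Qed.

Lemma continuous_soliton k : continuous (soliton k).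
Proof.
by move=> x; exact: is_derive_continuous (is_derive_soliton k x).
Qed.

Lemma continuous_soliton' k : continuous (soliton' k).
Proof.
move=> x; have c0 := cosh_gt0 (2 * k * x).
have s0 : 0 < Num.sqrt (cosh (2 * k * x)) by rewrite sqrtr_gt0.
apply: cvgM.
  by apply: cvgN; apply: cvgM; [exact: cvg_cst|exact: continuous_sinh2].
apply: cvgV; first by rewrite mulf_neq0// gt_eqF.
apply: cvgM; first exact: continuous_cosh2.
by apply: (@continuous_comp _ _ _ (fun x => cosh (2 * k * x)) Num.sqrt);
  [exact: continuous_cosh2|exact: sqrt_continuous].
Qed.

Lemma soliton_primitive k : primitive (soliton k) (soliton' k).
Proof.
by apply: antiderivative_primitive; [exact: continuous_soliton'|exact: is_derive_soliton].
Qed.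

Lemma segment_integral_soliton2 k x y : k != 0 -> x <= y ->
  \I[x, y] (fun z => soliton k z ^+ 2) = soliton2_prim k y - soliton2_prim k x.
Proof.
move=> k0 xy; suff h : primitive (soliton2_prim k) (fun z => soliton k z ^+ 2) by rewrite h.
apply: antiderivative_primitive => [|z]; first exact/continuousX/continuous_soliton.
exact: is_derive_soliton2_prim.
Qed.

Lemma segment_integral_soliton6 k x y : k != 0 -> x <= y ->
  \I[x, y] (fun z => soliton k z ^+ 6) = soliton6_prim k y - soliton6_prim k x.
Proof.
move=> k0 xy; suff h : primitive (soliton6_prim k) (fun z => soliton k z ^+ 6) by rewrite h.
apply: antiderivative_primitive => [|z]; first exact/continuousX/continuous_soliton.
exact: is_derive_soliton6_prim.
Qed.

Lemma segment_integral_soliton'2 k x y :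
  \I[x, y] (fun z => soliton' k z ^+ 2) =
  k ^+ 2 * (\I[x, y] (fun z => soliton k z ^+ 2) - \I[x, y] (fun z => soliton k z ^+ 6)).
Proof.
have i2 := continuous_locint (continuousX (n := 2) (@continuous_soliton k)).
have i6 := continuous_locint (continuousX (n := 6) (@continuous_soliton k)).
transitivity (\I[x, y] (fun z => k ^+ 2 * soliton k z ^+ 2 + - k ^+ 2 * soliton k z ^+ 6)).
  by apply: eq_segment_integral => z _; rewrite soliton'2; ring.
by rewrite segment_integralD; [rewrite !segment_integralZ//; ring|exact: locintZ..].
Qed.

Lemma sinh0 : sinh 0 = 0.
Proof. by rewrite /sinh oppr0 subrr mul0r. Qed.

Lemma sinhN x : sinh (- x) = - sinh x.
Proof. by rewrite /sinh opprK; field. Qed.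

(** A quantitative form of atan (sinh (2 k)) -> pi/2: sinh (2 k) >= k >= tan t. *)
Lemma atan_sinh_ge (t : R) k : 0 < t < pi / 2 -> tan t <= k -> t <= atan (sinh (2 * k)).
Proof.
move=> /andP[t0 tpi] tk.
have tt : atan (tan t) = t by rewrite tanK// in_itv/=; lra.
have tan0 : 0 <= tan t.
  rewrite divr_ge0// ?sin_ge0_pi ?cos_ge0_pihalf//; have := pi_gt0 R; lra.
rewrite -{1}tt; apply: le_atan; apply: (le_trans tk).
have := @sinh_ge (2 * k); lra.
Qed.

End soliton.

(** * The value of the quotient at the profile on the line *)

Section upper_bounds.
Variable R : realType.
Notation mu := (@lebesgue_measure R).
Implicit Types (k t : R).

Lemma soliton_sint k x : soliton k x = soliton k 0 + sint 0 x (soliton' k).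
Proof.
have p := @soliton_primitive R k; rewrite /sint.
by case: leP => [x0|/ltW x0]; rewrite -(p _ _ x0); ring.
Qed.

Lemma segment_integral_soliton2_le k n : 0 < k -> 0 <= n ->
  \I[- n, n] (fun x => soliton k x ^+ 2) <= pi / (2 * k).
Proof.
move=> k0 n0; rewrite segment_integral_soliton2 ?gt_eqF//; last lra.
rewrite /soliton2_prim -mulrBl ler_pM2r ?invr_gt0 ?mulr_gt0//.
have := atan_ltpi2 (sinh (2 * k * n)); have := atan_gtNpi2 (sinh (2 * k * - n)); lra.
Qed.

(** One-sided bounds suffice for k = 1: pi/4 above for the integral of u'^2, pi/2 above for u^2 and
    pi/4 below for u^6. *)
Lemma G1_le : (G1 R <= (pi ^+ 2 / 4 : R)%:E)%E.
Proof.
pose u : R -> R := soliton 1; pose g : R -> R := soliton' 1.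
have cu : continuous u := @continuous_soliton R 1.
have cg : continuous g := @continuous_soliton' R 1.
have u2 := continuousX (n := 2) cu; have u6 := continuousX (n := 6) cu.
have g2 := continuousX (n := 2) cg.
have u20 x : 0 <= u x ^+ 2 by exact: sqr_ge0.
have g20 x : 0 <= g x ^+ 2 by exact: sqr_ge0.
have u60 x : 0 <= u x ^+ 6 by exact: exprn_even_ge0.
have pi0 := pi_gt0 R.
have n0 (n : nat) : 0 <= n%:R :> R by [].
have B_le (n : nat) : \I[- n%:R, n%:R] (fun x => u x ^+ 2) <= pi / 2.
  by have := segment_integral_soliton2_le ltr01 (n0 n); rewrite mulr1.
(* A crude bound from 0 < u <= 1, which serves to establish integrability. *)
have C_le (n : nat) : \I[- n%:R, n%:R] (fun x => u x ^+ 6) <= pi / 2.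
  apply: le_trans (B_le n); apply: segment_integral_le => [||x _]; try exact: continuous_locint.
  by rewrite -[6%N]/(2 + 4)%N exprD ler_piMr// exprn_ile1// ?soliton_le1// ltW// soliton_gt0.
have C_E (n : nat) : \I[- n%:R, n%:R] (fun x => u x ^+ 6) =
    (sinh (2 * n%:R) / cosh (2 * n%:R) ^+ 2 + atan (sinh (2 * n%:R))) / 2.
  have nn : - n%:R <= n%:R :> R by rewrite (le_trans _ (n0 n))// oppr_le0.
  rewrite segment_integral_soliton6 ?oner_neq0// /soliton6_prim !mulr1.
  have coshN (x : R) : cosh (- x) = cosh x by rewrite /cosh opprK addrC.
  by rewrite mulrN sinhN coshN atanN; field; rewrite gt_eqF// cosh_gt0.
have A_le (n : nat) : \I[- n%:R, n%:R] (fun x => g x ^+ 2) <= pi / 4.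
  have nn : - n%:R <= n%:R :> R by rewrite (le_trans _ (n0 n))// oppr_le0.
  rewrite segment_integral_soliton'2 expr1n mul1r C_E.
  rewrite segment_integral_soliton2 ?oner_neq0// /soliton2_prim !mulr1 mulrN sinhN atanN.
  have : 0 <= sinh (2 * n%:R) / cosh (2 * n%:R) ^+ 2 :> R.
    have s0 := @sinh_ge R (2 * n%:R) (mulr_ge0 (ler0n _ 2) (n0 n)).
    by rewrite divr_ge0 ?sqr_ge0// (le_trans _ s0)// divr_ge0// mulr_ge0.
  have := atan_ltpi2 (sinh (2 * n%:R) : R); lra.
have int (f : R -> R) K : continuous f -> (forall x, 0 <= f x) ->
    (forall n : nat, \I[- n%:R, n%:R] f <= K) -> mu.-integrable setT (EFin \o f).
  move=> cf f0 fK; apply/integrableP; split.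
    by apply/measurable_EFinP; exact: continuous_measurable_fun.
  apply: (le_lt_trans _ (ltey K%:E)); apply: le_trans (integral_line_le cf f0 fK).
  rewrite le_eqVlt; apply/orP; left; apply/eqP.
  by apply: eq_integral => x _ /=; rewrite ger0_norm.
have fin (f : R -> R) : mu.-integrable setT (EFin \o f) ->
    (\int[mu]_x (f x)%:E)%E = (Rintegral mu setT f)%:E.
  by move=> fi; rewrite /Rintegral fineK//; exact: integrable_fin_num.
have u2i := int _ _ u2 u20 B_le.
have u6i := int _ _ u6 u60 C_le.
have g2i := int _ _ g2 g20 A_le.
have := integral_line_le g2 g20 A_le; have := integral_line_le u2 u20 B_le.
rewrite !fin// !lee_fin; set A := Rintegral _ _ _; set B := Rintegral _ _ _ => Bpi Api.
set C := Rintegral mu setT (fun x => u x ^+ 6).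
have B0 : 0 <= B by apply: Rintegral_ge0.
have A0 : 0 <= A by apply: Rintegral_ge0.
have Cpi : pi / 4 <= C.
  (* If C < pi/4, then t = pi/4 + C is below pi/2 while t / 2 > C. *)
  suff h (t : R) : 0 < t < pi / 2 -> t / 2 <= C.
    have C0 : 0 <= C by apply: Rintegral_ge0.
    rewrite leNgt; apply/negP => h1.
    have /h : 0 < pi / 4 + C < pi / 2 by lra.
    lra.
  move=> tpi; pose n := Num.bound `|tan t|.
  have tn : tan t <= n%:R by apply: le_trans (ler_norm _) _; exact/ltW/archi_boundP.
  have := atan_sinh_ge tpi tn; have := segment_integral_le_line (- n%:R) n%:R u6i u60.
  rewrite C_E -/C.
  have : 0 <= sinh (2 * n%:R) / cosh (2 * n%:R) ^+ 2 :> R.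
    have s0 := @sinh_ge R (2 * n%:R) (mulr_ge0 (ler0n _ 2) (n0 n)).
    by rewrite divr_ge0 ?sqr_ge0// (le_trans _ s0)// divr_ge0// mulr_ge0.
  lra.
apply: (@le_trans _ _ (quotR u g)).
  apply: ereal_inf_lbound; exists u, g; split => //.
    split; first exact: continuous_measurable_fun.
    split; first exact: continuous_measurable_fun.
    do 2 split => //.
    by exists (u 0); apply: aeW => x; exact: soliton_sint.
  move=> u_eq0.
  have := @ae_eq_integral_comp R setT u (fun=> 0) (fun s => s ^+ 6) measurableT
    (continuous_measurable_fun cu) _ (@exprn_continuous _ 6) _.
  rewrite fin// -/C expr0n/= integral0 => h.
  have {h} [C0] : C%:E = 0%E.
    by apply: h => [|]; [move=> x; exact: cvg_cst|exact: ae_imply u_eq0].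
  lra.
rewrite /quotR !fin// -/C EFin_quot; last lra.
rewrite lee_fin ler_pdivrMr; last lra.
apply: (@le_trans _ _ (pi / 4 * (pi / 2) ^+ 2)).
  by apply: ler_pM; rewrite ?sqr_ge0// ler_pXn2r ?nnegrE//; lra.
have -> : pi / 4 * (pi / 2) ^+ 2 = pi ^+ 2 / 4 * (pi / 4) :> R by field.
by rewrite ler_wpM2l// divr_ge0 ?sqr_ge0.
Qed.

End upper_bounds.

(** * A minimizing family on [0,1] *)

Section interval_upper_bound.
Variable R : realType.
Notation mu := (@lebesgue_measure R).
Implicit Types (k t : R).

(** The tangent at m = 0 of the convex function m -> (u - m)^6. The difference is m^2 times a
    quartic, written here as a sum of squares. *)
Lemma sixth_power_tangent (u m : R) : u ^+ 6 - 6 * m * u ^+ 5 <= (u - m) ^+ 6.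
Proof.
have : 0 <= m ^+ 2 * (((u - m) ^+ 2 + (u - m) * u) ^+ 2 +
    2 * u ^+ 2 * (2 * u - m) ^+ 2 + 3 * u ^+ 4).
  have u4 : 0 <= u ^+ 4 by exact: exprn_even_ge0.
  apply: mulr_ge0; first exact: sqr_ge0.
  apply: addr_ge0; last exact: mulr_ge0.
  apply: addr_ge0; first exact: sqr_ge0.
  by apply: mulr_ge0; [apply: mulr_ge0|]; rewrite ?sqr_ge0.
move=> h; rewrite -subr_ge0; apply: (le_trans h).
by rewrite le_eqVlt; apply/orP; left; apply/eqP; ring.
Qed.

(** The bound is (k pi / 8) (pi / (4 k))^2 divided by t / (4 k), where these estimate the Dirichlet
    integral, the integral of u^2 and the denominator. At t = pi/2 it would equal pi^2/16. *)
Lemma quotI_soliton_le t : 0 < t < pi / 2 -> exists k : R,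
  [/\ W11I (soliton k) (soliton' k), nonconstI (soliton k) &
      (quotI (soliton k) (soliton' k) <= (pi ^+ 3 / (32 * t))%:E)%E].
Proof.
move=> /andP[t0 tpi]; have pi0 := pi_gt0 R.
(* Room is split in two: atan (sinh (2 k)) is brought above [th], and the gap [d] between [th] and
   [t] absorbs the effect of the mean. *)
pose th := (t + pi / 2) / 2; pose d := th - t.
have d0 : 0 < d by rewrite /d /th; lra.
have thpi : 0 < th < pi / 2 by rewrite /th; lra.
(* The last bound makes the mean m small: 6 pi m <= d, see md below. *)
pose k := Num.max 1 (Num.max (tan th) (9 * pi ^+ 3 / d ^+ 2)); exists k.
have k1 : 1 <= k by rewrite /k le_max lexx.
have ktan : tan th <= k by rewrite /k !le_max lexx orbT.
have kd : 9 * pi ^+ 3 / d ^+ 2 <= k by rewrite /k !le_max lexx !orbT.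
clearbody k.
have k0 : 0 < k by lra.
have kN0 : k != 0 by rewrite gt_eqF.
pose u : R -> R := soliton k; pose g : R -> R := soliton' k.
have cu : continuous u := @continuous_soliton R k.
have cg : continuous g := @continuous_soliton' R k.
have u2 := continuousX (n := 2) cu; have u6 := continuousX (n := 6) cu.
have g2 := continuousX (n := 2) cg.
have ui := continuous_locint cu.
have u2i := continuous_locint u2; have u6i := continuous_locint u6.
have ci (c : R) : locint (fun=> c) by apply: continuous_locint => ?; exact: cvg_cst.
pose a := atan (sinh (2 * k)); pose r := sinh (2 * k) / cosh (2 * k) ^+ 2.
have r0 : 0 <= r.
  have s0 := @sinh_ge R (2 * k) (mulr_ge0 (ler0n _ 2) (ltW k0)).
  by rewrite divr_ge0 ?sqr_ge0// (le_trans _ s0)// divr_ge0// mulr_ge0// ltW.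
have api : a < pi / 2 by exact: atan_ltpi2.
have tha : th <= a by exact: atan_sinh_ge.
have BE : \I[0, 1] (fun x => u x ^+ 2) = a / (2 * k).
  rewrite segment_integral_soliton2// /soliton2_prim mulr1 mulr0 sinh0 atan0.
  by rewrite mul0r subr0.
have CE : \I[0, 1] (fun x => u x ^+ 6) = (r + a) / (4 * k).
  rewrite segment_integral_soliton6// /soliton6_prim mulr1 mulr0 sinh0 atan0.
  by rewrite !mul0r addr0 mul0r subr0.
have AE : \I[0, 1] (fun x => g x ^+ 2) = k * (a - r) / 4.
  by rewrite segment_integral_soliton'2 BE CE; field.
set B := \I[0, 1] (fun x => u x ^+ 2) in BE.
set A := \I[0, 1] _ in AE.
have B0 : 0 <= B by apply: segment_integral_ge0 => x _; exact: sqr_ge0.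
have A0 : 0 <= A by apply: segment_integral_ge0 => x _; exact: sqr_ge0.
have Bpi : B <= pi / (4 * k).
  by rewrite BE ler_pdivrMr ?mulr_gt0// (_ : _ * (2 * k) = pi / 2); [exact: ltW|field].
have Api : A <= k * pi / 8.
  have : k * (a - r) <= k * (pi / 2) by rewrite ler_wpM2l ?(ltW k0)//; lra.
  by rewrite AE; lra.
pose m := meanI u.
have m0 : 0 <= m by apply: Rintegral_ge0 => x _; exact/ltW/soliton_gt0.
(* Cauchy-Schwarz, from the integral of (u - m)^2 being nonnegative. As B <= pi / (4 k), the mean is
   at most of order k^(-1/2). *)
have m2B : m ^+ 2 <= B.
  have : 0 <= \I[0, 1] (fun x => u x ^+ 2 + (- (2 * m) * u x + m ^+ 2)).
    apply: segment_integral_ge0 => x _.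
    by rewrite (_ : _ + _ = (u x - m) ^+ 2) ?sqr_ge0//; ring.
  rewrite segment_integralD//; last by apply: locintD => //; exact: locintZ.
  rewrite segment_integralD//; last exact: locintZ.
  by rewrite segment_integralZ// segment_integral_cst// -/B -[\I[0, 1] u]/m; lra.
have md : 6 * m * pi <= d.
  have : (6 * m * pi) ^+ 2 <= d ^+ 2.
    have -> : (6 * m * pi) ^+ 2 = 36 * pi ^+ 2 * m ^+ 2 by ring.
    apply: (@le_trans _ _ (36 * pi ^+ 2 * (pi / (4 * k)))).
      apply: ler_wpM2l; last exact: le_trans Bpi.
      by apply: mulr_ge0; rewrite ?sqr_ge0.
    rewrite (_ : _ * _ = 9 * pi ^+ 3 / k); last by field.
    by move: kd; rewrite !ler_pdivrMr ?exprn_gt0// (mulrC k).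
  have q0 : 0 <= 6 * m * pi by apply: mulr_ge0; [exact: mulr_ge0|exact: ltW].
  by rewrite ler_pXn2r ?nnegrE// ltW.
have w6 : continuous (fun x => `|u x - m| ^+ 6).
  apply: continuousX => x; apply: cvg_norm.
  by apply: cvgB; [exact: cu|exact: cvg_cst].
set W := \I[0, 1] (fun x => `|u x - m| ^+ 6).
(* The tangent bound with u^5 <= u^2, valid as 0 < u <= 1, expresses the loss due to the mean as 6 m
   B <= d / (4 k). *)
have tW : t / (4 * k) <= W.
  have h : \I[0, 1] (fun x => u x ^+ 6 + - (6 * m) * u x ^+ 2) <= W.
    apply: segment_integral_le => [||x _].
    - by apply: locintD => //; exact: locintZ.
    - exact: continuous_locint.
    - rewrite -normrX ger0_norm; last exact: exprn_even_ge0.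
      apply: le_trans (sixth_power_tangent _ _); rewrite mulNr lerD2l lerN2.
      rewrite ler_wpM2l ?mulr_ge0// -[5%N]/(2 + 3)%N exprD ler_piMr ?sqr_ge0//.
      by rewrite exprn_ile1 ?soliton_le1// ltW// soliton_gt0.
  rewrite segment_integralD// in h; last exact: locintZ.
  rewrite segment_integralZ// CE -/B in h.
  have h1 : 6 * m * B <= d / (4 * k).
    apply: (@le_trans _ _ (6 * m * (pi / (4 * k)))).
      by rewrite ler_wpM2l// mulr_ge0.
    by rewrite mulrA ler_pM2r// invr_gt0 mulr_gt0.
  have h2 : th / (4 * k) <= (r + a) / (4 * k).
    by rewrite ler_pM2r ?invr_gt0 ?mulr_gt0//; lra.
  have h3 : t / (4 * k) = th / (4 * k) - d / (4 * k) by rewrite -mulrBl /d; congr (_ / _); ring.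
  lra.
have W0 : 0 < W by apply: lt_le_trans tW; rewrite divr_gt0// mulr_gt0.
have WE : (\int[mu]_(x in @I01 R) (`|u x - m| ^+ 6)%:E)%E = W%:E.
  by rewrite segment_integral_EFin//; exact: continuous_locint.
have mu_u (f : R -> R) : continuous f -> measurable_fun (@I01 R) f.
  by move=> cf; apply: measurable_funTS; exact: continuous_measurable_fun.
split.
- split; first exact: mu_u.
  split; first exact: mu_u.
  split; first exact: (continuous_locint cg).
  exists (u 0); apply: aeW => x; rewrite inE /I01/= in_itv/= => /andP[x0 _].
  by rewrite -(@soliton_primitive R k _ _ x0) -/u; ring.
- move=> [c uc].
  have cst_c : continuous (fun _ : R => c) by move=> ?; exact: cvg_cst.
  have cc (F : R -> R) (cF : continuous F) := @ae_eq_integral_comp R (@I01 R) u (fun=> c) F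
    (measurable_itv _) (mu_u _ cu) cst_c cF
    (@ae_imply R (fun x => x \in @I01 R -> u x = c) (fun x => @I01 R x -> u x = c)
      (fun x h xI => h (mem_set xI)) uc).
  have mc : m = c.
    have cid : continuous (@id R) by move=> x; exact: cvg_id.
    have e : (\int[mu]_(x in @I01 R) (u x)%:E = \int[mu]_(x in @I01 R) c%:E)%E := cc id cid.
    move: e; rewrite (segment_integral_EFin _ _ ui) (segment_integral_EFin _ _ (ci c)) => -[].
    by rewrite segment_integral_cst// subr0 mulr1.
  have := cc (fun s => `|s - m| ^+ 6) _; rewrite WE mc subrr normr0 expr0n integral0 => h.
  have [W00] : W%:E = 0%E.
    apply: h; apply: continuousX => x; apply: cvg_norm.
    by apply: cvgB; [exact: cvg_id|exact: cvg_cst].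
  by move: W0; rewrite W00 ltxx.
- rewrite /quotI -/u -/g -/m WE.
  rewrite !segment_integral_EFin//; last exact: continuous_locint.
  rewrite -/A -/B EFin_quot// lee_fin ler_pdivrMr//.
  apply: (@le_trans _ _ (k * pi / 8 * (pi / (4 * k)) ^+ 2)).
    apply: ler_pM; rewrite ?sqr_ge0// ler_pXn2r ?nnegrE//.
    by rewrite divr_ge0 ?mulr_ge0// ltW.
  have -> : k * pi / 8 * (pi / (4 * k)) ^+ 2 = pi ^+ 3 / (32 * t) * (t / (4 * k)).
    by field; rewrite kN0/=; lra.
  by rewrite ler_wpM2l// divr_ge0 ?exprn_ge0 ?mulr_ge0// ltW.
Qed.

Lemma GQ1_le : (GQ1 R <= (pi ^+ 2 / 16 : R)%:E)%E.
Proof.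
have pi0 := pi_gt0 R.
apply/lee_addgt0Pr => e e0.
(* Solves pi^3 / (32 t) = pi^2/16 + e. *)
pose t := pi ^+ 3 / (32 * (pi ^+ 2 / 16 + e)).
have p2 : 0 < pi ^+ 2 / 16 + e by rewrite addr_gt0// divr_gt0 ?exprn_gt0.
have ht : 0 < t < pi / 2.
  rewrite divr_gt0 ?exprn_gt0 ?mulr_gt0//= ltr_pdivrMr ?mulr_gt0//.
  have -> : pi / 2 * (32 * (pi ^+ 2 / 16 + e)) = pi ^+ 3 + 16 * (pi * e) by field.
  by rewrite ltrDl !mulr_gt0.
have [k [Wk nk qk]] := quotI_soliton_le ht.
apply: (@le_trans _ _ (quotI (soliton k) (soliton' k))).
  by apply: ereal_inf_lbound; exists (soliton k), (soliton' k).
apply: (le_trans qk); rewrite -EFinD lee_fin /t.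
rewrite le_eqVlt; apply/orP; left; apply/eqP; field.
by rewrite !gt_eqF//; lra.
Qed.

End interval_upper_bound.

(** Non-attainment is the strictness of [quotI_gt]: a minimizer would have quotient exactly
    pi^2/16. *)
Theorem theorem4p2 (R : realType) :
  GQ1 R = (G1 R * (4^-1 : R)%:E)%E /\
  (G1 R * (4^-1 : R)%:E)%E = ((pi : R) ^+ 2 / 16)%:E /\
  ~ (exists u g : R -> R, W11I u g /\ nonconstI u /\ quotI u g = GQ1 R).
Proof.
have G1E : G1 R = (pi ^+ 2 / 4 : R)%:E.
  apply/le_anti; rewrite G1_le/=; apply/ereal_infP => _ [u [g [ug u0 ->]]].
  exact: quotR_ge.
have GQ1E : GQ1 R = (pi ^+ 2 / 16 : R)%:E.
  apply/le_anti; rewrite GQ1_le/=; apply/ereal_infP => _ [u [g [ug nc ->]]].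
  exact/ltW/quotI_gt.
have G14 : (G1 R * (4^-1 : R)%:E)%E = ((pi : R) ^+ 2 / 16)%:E.
  by rewrite G1E -EFinM; congr EFin; field.
rewrite G14 GQ1E; do 2 split => //; move=> [u [g [ug [nc uE]]]].
by have := quotI_gt ug nc; rewrite uE ltxx.
Qed.
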